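(* Assume $g$ is $\mu_g$-strongly convex and $L_g$-smooth on $\mathbb{R}^n$ and $f(x)=\max_{(v,b)\in\mathcal V}\{v^\top x+b\}$ is convex piecewise linear. For every $\epsilon>0$, Kelley's method applied to $\min_{x\in\mathbb{R}^n}\{g(x)+f(x)\}$ finds an $\epsilon$-optimal solution in at most $$1+\max\left\{2,\frac{D^2}{\bar\mu_\psi\,\mu_g\,\gamma^2}\right\}\log\left(\frac{D^2}{2\epsilon\mu_g}\right)$$ iterations, where $$\bar\mu_\psi=\frac12\left(D_b+3\,\frac{4M_f^2}{\mu_g}+6M_f\|x^*\|+2L_g\left[\left(\frac{2M_f}{\mu_g}+\|x^*\|\right)^2+1\right]\right)^{-1}.$$
   Context: Setting: $\mathcal V\subset\mathbb{R}^n\times\mathbb{R}$ is a finite nonempty set, $g:\mathbb{R}^n\to\mathbb{R}$, $f(x)=\max_{(v,b)\in\mathcal V}\{v^\top x+b\}$, $h=g+f$, and $x^*$ is an optimal solution of $\min_x h(x)$. A point $x$ is $\epsilon$-optimal if $h(x)-h(x^* )\le\epsilon$. ''$L_g$-smooth'' means $\nabla g$ is $L_g$-Lipschitz; ''$\mu_g$-strongly convex'' means $g(y)\ge g(x)+\langle\nabla g(x),y-x\rangle+\frac{\mu_g}{2}\|x-y\|^2$ for all $x,y$. Norms are Euclidean. Constants: $M_f$ is the Lipschitz constant of $f$; $D$ is the diameter of $\mathrm{conv}(\mathcal V)\subset\mathbb{R}^{n+1}$; $D_b$ is the diameter of the projection of $\mathrm{conv}(\mathcal V)$ onto its last coordinate;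 $\gamma$ is the pyramidal width of $\mathcal V$. Pyramidal width: for a finite set $A\subset\mathbb{R}^{n+1}$, a nonzero direction $r$ and a point $u\in\mathrm{conv}(A)$, let $\mathrm{PdirW}(A,r,u)=\min_{S}\max_{a\in A,\,s\in S}\langle r/\|r\|,a-s\rangle$, where $S$ ranges over subsets of $A$ such that $u$ is a convex combination with strictly positive weights of all the elements of $S$. Then $\mathrm{PWidth}(\mathcal V)=\min \mathrm{PdirW}(\mathcal K\cap\mathcal V,r,u)$ over all faces $\mathcal K$ of $\mathrm{conv}(\mathcal V)$, all $u\in\mathcal K$ and all $r\in\mathrm{cone}(\mathcal K-u)\setminus\{0\}$. Kelley's method with accuracy $\epsilon$: start from a nonempty $\mathcal V^0\subseteq\mathcal V$. For $k=0,1,2,\dots$: let $f_k(x)=\max_{(v,b)\in\mathcal V^k}\{v^\top x+b\}$; compute $x_{k+1}\in\arg\min_x\{g(x)+f_k(x)\}$; choose $(v_{k+1},b_{k+1})\in\arg\max_{(v,b)\in\mathcal V}\{v^\top x_{k+1}+b\}$; set $\mathcal V^{k+1}=\mathcal V^k\cup\{(v_{k+1},b_{k+1})\}$; if $f(x_{k+1})-f_k(x_{k+1})\le\epsilon$, terminate and return $x_{k+1}$.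
   Formalization: The bound is replaced by its maximum with 0 (it can be negative); iterations are numbered from k=0, so computing x_1 is not counted; ''finds'' means some iterate x_{k+1} computed no later than termination is ε-optimal, not that the stopping test succeeds within the bound. *)

(* Defs.v *)
From HB Require Import structures.
From mathcomp Require Import all_boot all_order all_algebra finmap.
From mathcomp Require Import all_classical all_reals all_analysis.

Set Implicit Arguments.
Unset Strict Implicit.
Unset Printing Implicit Defensive.

Import Order.TTheory GRing.Theory Num.Theory.
Import numFieldNormedType.Exports.

Local Open Scope classical_set_scope.
Local Open Scope ring_scope.

(* The library norm on 'rV[R]_m is the sup norm; it induces the same topology,
   hence the same notion of differentiability, as the Euclidean norm below. *)
Definition dot (R : realType) (m : nat) (u v : 'rV[R]_m) : R :=
  \sum_(i < m) u 0 i * v 0 i.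

Definition norm2 (R : realType) (m : nat) (u : 'rV[R]_m) : R :=
  Num.sqrt (dot u u).

Definition diameter (R : realType) (m : nat) (A : set 'rV[R]_m) : R :=
  sup [set norm2 (p - q) | p in A & q in A].

Definition gradient (R : realType) (n : nat) (g : 'rV[R]_n -> R)
    (x : 'rV[R]_n) : 'rV[R]_n :=
  \row_(i < n) 'D_(delta_mx 0 i) g x.

Definition smooth (R : realType) (n : nat) (L : R) (g : 'rV[R]_n -> R) : Prop :=
  (forall x, differentiable g x) /\
  (forall x y, norm2 (gradient g x - gradient g y) <= L * norm2 (x - y)).

Definition strongly_convex (R : realType) (n : nat) (mu : R)
    (g : 'rV[R]_n -> R) : Prop :=
  forall x y,
    g x + dot (gradient g x) (y - x) + mu / 2 * norm2 (x - y) ^+ 2 <= g y.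

Definition minimizer (R : realType) (T : Type) (h : T -> R) (x : T) : Prop :=
  forall y, h x <= h y.

Definition lipschitz_const (R : realType) (n : nat) (f : 'rV[R]_n -> R) : R :=
  inf [set M | 0 <= M /\ forall x y, `|f x - f y| <= M * norm2 (x - y)].

Definition conv_hull (R : realType) (m : nat) (A : {fset 'rV[R]_m}) :
    set 'rV[R]_m :=
  [set u | exists w : 'rV[R]_m -> R,
     [/\ forall a, a \in A -> 0 <= w a,
         \sum_(a <- A) w a = 1
       & u = \sum_(a <- A) w a *: a]].

Definition proper_comb (R : realType) (m : nat) (S : {fset 'rV[R]_m})
    (u : 'rV[R]_m) : Prop :=
  exists w : 'rV[R]_m -> R,
    [/\ forall s, s \in S -> 0 < w s,
        \sum_(s <- S) w s = 1
      & u = \sum_(s <- S) w s *: s].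

Definition is_face (R : realType) (m : nat) (C K : set 'rV[R]_m) : Prop :=
  [/\ K `<=` C,
      convex_set (K : set (convex_lmodType 'rV[R]_m))
    & forall x y (t : R), C x -> C y -> 0 < t < 1 ->
        K (t *: x + (1 - t) *: y) -> K x /\ K y].

(* The cone generated by a set that is convex, as K - u is below. *)
Definition cone (R : realType) (m : nat) (A : set 'rV[R]_m) : set 'rV[R]_m :=
  [set t *: a | t in [set t : R | 0 <= t] & a in A].

Definition PdirW (R : realType) (m : nat) (A : {fset 'rV[R]_m})
    (r u : 'rV[R]_m) : R :=
  inf [set sup [set dot ((norm2 r)^-1 *: r) (a - s) | a in [set` A] & s in [set` S]]
      | S in [set S : {fset 'rV[R]_m} |
                 (S `<=` A)%fset /\ proper_comb S u]].

Definition PWidth (R : realType) (m : nat) (V : {fset 'rV[R]_m}) : R :=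
  inf [set d | exists (K : set 'rV[R]_m) (u r : 'rV[R]_m),
     [/\ is_face (conv_hull V) K, K u,
         cone [set z - u | z in K] r, r != 0
       & d = PdirW [fset a in V | a \in K]%fset r u]].

(* A pair (v, b) of R^n x R is the row vector row_mx v b of R^(n + 1). *)
Definition slope (R : realType) (n : nat) (p : 'rV[R]_(n + 1)) : 'rV[R]_n :=
  lsubmx p.

Definition offset (R : realType) (n : nat) (p : 'rV[R]_(n + 1)) : R :=
  rsubmx p 0 0.

Definition affine (R : realType) (n : nat) (p : 'rV[R]_(n + 1))
    (x : 'rV[R]_n) : R :=
  dot (slope p) x + offset p.

Definition max_affine (R : realType) (n : nat) (V : {fset 'rV[R]_(n + 1)})
    (x : 'rV[R]_n) : R :=
  sup [set affine p x | p in [set` V]].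

(* The stopping test of iteration k fails. *)
Definition continues (R : realType) (n : nat) (V : {fset 'rV[R]_(n + 1)})
    (eps : R) (Vs : nat -> {fset 'rV[R]_(n + 1)}) (x : nat -> 'rV[R]_n)
    (k : nat) : Prop :=
  eps < max_affine V (x k.+1) - max_affine (Vs k) (x k.+1).

(* Iteration k computes x_{k+1}, p_{k+1} = (v_{k+1}, b_{k+1}) and V^{k+1}; it is
   performed only if the stopping tests of iterations 0, ..., k - 1 all failed.
   Past the stopping iteration, and at index 0 for x and p, the sequences are
   unconstrained. *)
Definition kelley_run (R : realType) (n : nat) (g : 'rV[R]_n -> R)
    (V : {fset 'rV[R]_(n + 1)}) (eps : R)
    (Vs : nat -> {fset 'rV[R]_(n + 1)}) (x : nat -> 'rV[R]_n)
    (p : nat -> 'rV[R]_(n + 1)) : Prop :=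
  [/\ Vs 0%N != fset0%fset, (Vs 0%N `<=` V)%fset
    & forall k : nat, (forall j, (j < k)%N -> continues V eps Vs x j) ->
        [/\ minimizer (fun y => g y + max_affine (Vs k) y) (x k.+1),
            p k.+1 \in V,
            forall q, q \in V -> affine q (x k.+1) <= affine (p k.+1) (x k.+1)
          & Vs k.+1 = (Vs k `|` [fset p k.+1])%fset]].

Definition mubar (R : realType) (Db Mf mu L nxstar : R) : R :=
  2^-1 * (Db + 3 * (4 * Mf ^+ 2 / mu) + 6 * Mf * nxstar
          + 2 * L * ((2 * Mf / mu + nxstar) ^+ 2 + 1))^-1.

(* Main.v *)
Require Import Defs.
From HB Require Import structures.
From mathcomp Require Import all_boot all_order all_algebra finmap.
From mathcomp Require Import all_classical all_reals all_analysis.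
From mathcomp Require Import ring lra.

Set Implicit Arguments.
Unset Strict Implicit.
Unset Printing Implicit Defensive.

Import Order.TTheory GRing.Theory Num.Theory.
Import numFieldNormedType.Exports.

Local Open Scope classical_set_scope.
Local Open Scope ring_scope.

(** Let delta_k be the optimal value minus the minimum of the model g + f_k, let
    G_k = (f - f_k)(x_{k+1}), Q = D^2 / (2 mu) and mubar = 1 / (2 B); then
    x_{k+1} is eps-optimal iff G_k - delta_k <= eps. Optimality of x_{k+1} for the
    model gives a convex combination u_k of active cuts with slope
    -grad g(x_{k+1}). Moving u_k a fraction t of the way to the new cut, strong
    convexity yields delta_{k+1} <= delta_k - t G_k + t^2 Q for t in [0, 1], hence
    delta_1 < Q - eps and delta_{k+1} <= delta_k - G_k^2 / (4 Q) as long as the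
    iterates are not eps-optimal.

    All cuts in u_k take the value f_k(x_{k+1}), so the pyramidal width gamma and
    cocoercivity of grad g bound delta_k: gamma^2 delta_k <= B' G_k^2, where
    B' <= 5 B / 12. This makes delta_k decrease linearly, but eps-optimality is a
    condition on G_k, which a priori is only of order sqrt(Q delta_k): delta_k has
    to fall to about eps^2 / (4 Q), twice the distance ln(Q / eps) on the
    logarithmic scale. The gain 12/5 of B' over B and the estimate
    G_k > eps + delta_k pay for the second half. *)

(** * Euclidean inner product and smooth strongly convex functions *)

Section Dot.
Variables (R : realType) (m : nat).
Implicit Types (u v w : 'rV[R]_m) (c : R).

Lemma dotC u v : dot u v = dot v u.
Proof. by apply: eq_bigr => i _; rewrite mulrC. Qed.

Lemma dotDl u v w : dot (u + v) w = dot u w + dot v w.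
Proof. by rewrite -big_split; apply: eq_bigr => i _; rewrite mxE mulrDl. Qed.

Lemma dotZl c u v : dot (c *: u) v = c * dot u v.
Proof. by rewrite mulr_sumr; apply: eq_bigr => i _; rewrite mxE mulrA. Qed.

Lemma dotDr u v w : dot u (v + w) = dot u v + dot u w.
Proof. by rewrite dotC dotDl !(dotC u). Qed.

Lemma dotZr c u v : dot u (c *: v) = c * dot u v.
Proof. by rewrite dotC dotZl dotC. Qed.

Lemma dotNl u v : dot (- u) v = - dot u v.
Proof. by rewrite -scaleN1r dotZl mulN1r. Qed.

Lemma dotNr u v : dot u (- v) = - dot u v.
Proof. by rewrite dotC dotNl dotC. Qed.

Lemma dotBl u v w : dot (u - v) w = dot u w - dot v w.
Proof. by rewrite dotDl dotNl. Qed.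

Lemma dotBr u v w : dot u (v - w) = dot u v - dot u w.
Proof. by rewrite dotDr dotNr. Qed.

Lemma dot0l v : dot 0 v = 0.
Proof. by rewrite -(scale0r 0) dotZl mul0r. Qed.

Lemma dot0r v : dot v 0 = 0.
Proof. by rewrite dotC dot0l. Qed.

Lemma dot_suml (I : Type) (s : seq I) (P : pred I) (F : I -> 'rV[R]_m) v :
  dot (\sum_(i <- s | P i) F i) v = \sum_(i <- s | P i) dot (F i) v.
Proof. by elim/big_rec2 : _ => [|i x y _ <-]; rewrite ?dot0l ?dotDl. Qed.

Lemma dot_sumr (I : Type) (s : seq I) (P : pred I) (F : I -> 'rV[R]_m) v :
  dot v (\sum_(i <- s | P i) F i) = \sum_(i <- s | P i) dot v (F i).
Proof. by rewrite dotC dot_suml; apply: eq_bigr => i _; exact: dotC. Qed.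

Lemma dot_ge0 u : 0 <= dot u u.
Proof. by apply: sumr_ge0 => i _; rewrite -expr2 sqr_ge0. Qed.

Lemma dot_eq0 u : (dot u u == 0) = (u == 0).
Proof.
apply/eqP/eqP => [|->]; last exact: dot0l.
move=> /eqP; rewrite psumr_eq0 => [/allP h|i _]; last by rewrite -expr2 sqr_ge0.
apply/rowP => i; rewrite mxE; apply/eqP.
by have := h i (mem_index_enum i); rewrite -expr2 sqrf_eq0.
Qed.

Lemma norm2_ge0 u : 0 <= norm2 u.
Proof. exact: sqrtr_ge0. Qed.

Lemma sqr_norm2 u : norm2 u ^+ 2 = dot u u.
Proof. exact: sqr_sqrtr (dot_ge0 u). Qed.

Lemma norm2_eq0 u : (norm2 u == 0) = (u == 0).
Proof. by rewrite -sqrf_eq0 sqr_norm2 dot_eq0. Qed.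

Lemma norm2_gt0 u : (0 < norm2 u) = (u != 0).
Proof. by rewrite lt_def norm2_ge0 andbT norm2_eq0. Qed.

Lemma norm2_0 : norm2 (0 : 'rV[R]_m) = 0.
Proof. by apply/eqP; rewrite norm2_eq0. Qed.

Lemma norm2Z c u : norm2 (c *: u) = `|c| * norm2 u.
Proof.
by rewrite /norm2 dotZl dotZr mulrA -expr2 sqrtrM ?sqr_ge0// sqrtr_sqr.
Qed.

Lemma norm2N u : norm2 (- u) = norm2 u.
Proof. by rewrite -scaleN1r norm2Z normrN1 mul1r. Qed.

Lemma norm2B u v : norm2 (u - v) = norm2 (v - u).
Proof. by rewrite -opprB norm2N. Qed.

Lemma dot_le_norm2 u v : dot u v <= norm2 u * norm2 v.
Proof.
have [->|v0] := eqVneq v 0; first by rewrite dot0r norm2_0 mulr0.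
have nv : 0 < norm2 v by rewrite norm2_gt0.
apply: (@le_trans _ _ `|dot u v|); first exact: ler_norm.
rewrite -(@ler_sqr R) ?nnegrE ?mulr_ge0 ?norm2_ge0//.
rewrite real_normK ?num_real// exprMn !sqr_norm2.
(* This vector is [dot v v] times the component of [u] orthogonal to [v]. *)
have := dot_ge0 (dot v v *: u - dot u v *: v).
rewrite !(dotBl, dotBr, dotZl, dotZr) (dotC v u) => h.
have vv : 0 < dot v v by rewrite -sqr_norm2 exprn_gt0.
rewrite -(ler_pM2l vv); lra.
Qed.

Lemma ler_norm_dot u v : `|dot u v| <= norm2 u * norm2 v.
Proof.
by rewrite ler_norml dot_le_norm2 andbT lerNl -dotNl (le_trans (dot_le_norm2 _ _))// norm2N.
Qed.

Lemma ler_norm2D u v : norm2 (u + v) <= norm2 u + norm2 v.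
Proof.
rewrite -(@ler_sqr R) ?nnegrE ?addr_ge0 ?norm2_ge0//.
rewrite sqrrD !sqr_norm2 dotDl !dotDr (dotC v u).
by have := dot_le_norm2 u v; lra.
Qed.

Lemma ler_norm2B u v : norm2 (u - v) <= norm2 u + norm2 v.
Proof. by rewrite (le_trans (ler_norm2D _ _))// norm2N. Qed.

Lemma ler_norm2_sum (I : Type) (s : seq I) (P : pred I) (F : I -> 'rV[R]_m) :
  norm2 (\sum_(i <- s | P i) F i) <= \sum_(i <- s | P i) norm2 (F i).
Proof.
elim/big_ind2 : _ => [|a b c d h1 h2|//]; first by rewrite norm2_0.
by apply: le_trans (ler_norm2D _ _) _; exact: lerD.
Qed.

Lemma ler_coord_norm2 u (i : 'I_m) : `|u 0 i| <= norm2 u.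
Proof.
rewrite -(@ler_sqr R) ?nnegrE ?norm2_ge0// real_normK ?num_real// sqr_norm2.
by rewrite /dot (bigD1 i)//= expr2 lerDl sumr_ge0// => j _; rewrite -expr2 sqr_ge0.
Qed.

End Dot.

Section SmoothStronglyConvex.
Variables (R : realType) (n : nat) (g : 'rV[R]_n -> R) (mu L : R).
Hypotheses (mu0 : 0 < mu) (g_cvx : strongly_convex mu g) (g_smooth : smooth L g).
Local Notation G := (gradient g).

Lemma gradient_monotone x y :
  mu * norm2 (x - y) ^+ 2 <= dot (G x - G y) (x - y).
Proof.
have := g_cvx x y; have := g_cvx y x.
rewrite (norm2B y x) !(dotBl, dotBr); lra.
Qed.

Lemma subgradient_le x y : g x + dot (G x) (y - x) <= g y.
Proof.
apply: le_trans (g_cvx x y); rewrite lerDl mulr_ge0 ?sqr_ge0// divr_ge0 ?ltW//.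
Qed.

(* Iterating the halving [c -> c / 2 + L / 4], which has fixed point [L / 2],
   from the value [L] given by convexity alone avoids any integration. *)
Lemma descent_halving (k : nat) x y :
  g y <= g x + dot (G x) (y - x) + (L / 2 + L / 2 / 2 ^+ k) * norm2 (y - x) ^+ 2.
Proof.
have lip u v w : dot (G u - G v) w <= L * norm2 (u - v) * norm2 w.
  apply: le_trans (dot_le_norm2 _ _) _.
  by apply: ler_wpM2r; [exact: norm2_ge0|exact: g_smooth.2].
elim: k x y => [|k IH] x y.
  have := subgradient_le y x; have := lip y x (y - x).
  rewrite expr0 divr1 (_ : L / 2 + L / 2 = L); last by field.
  rewrite -mulrA -expr2 !(dotBl, dotBr); lra.
(* The inductive bound is used on both halves of the segment; replacing the gradient at [z] by that
   at [x] costs L / 4 times the squared length. *)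
pose z := x + 2^-1 *: (y - x).
have zx : z - x = 2^-1 *: (y - x) by rewrite /z addrC addKr.
have yz : y - z = 2^-1 *: (y - x).
  by rewrite /z opprD addrA -{1}[y - x]scale1r -scalerBl; congr (_ *: _); field.
have nz : norm2 (2^-1 *: (y - x)) = norm2 (y - x) / 2.
  by rewrite norm2Z ger0_norm ?invr_ge0// mulrC.
have := IH x z; have := IH z y; have := lip z x (y - z).
rewrite zx yz nz !dotZr (exprSr (2 : R) k) invfM dotBl => h1 h2 h3.
set c := (2 ^+ k)^-1 in h2 h3 *.
set N := norm2 (y - x) in h1 h2 h3 *.
set a := dot (G z) _ in h1 h2 h3; set b := dot (G x) _ in h1 h2 h3 *.
lra.
Qed.

Lemma descent_le x y : g y <= g x + dot (G x) (y - x) + L / 2 * norm2 (y - x) ^+ 2.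
Proof.
apply/ler_addgt0Pr => e e0.
pose C := `|L / 2| * norm2 (y - x) ^+ 2.
have C0 : 0 <= C by rewrite mulr_ge0 ?sqr_ge0.
(* As k < 2^k, this many halvings bring the excess term below [e]. *)
pose k := (Num.truncn (C / e)).+1.
have k2 : C / e <= 2 ^+ k.
  apply: (@le_trans _ _ k%:R); first by rewrite ltW// /k truncnS_gt.
  by rewrite -natrX ler_nat ltnW// ltn_expl.
apply: le_trans (descent_halving k x y) _.
rewrite mulrDl !addrA lerD2l.
have p2 : 0 < 2 ^+ k :> R by rewrite exprn_gt0.
rewrite mulrAC ler_pdivrMr//.
rewrite ler_pdivrMr// mulrC in k2; apply: le_trans k2; rewrite /C.
by rewrite ler_wpM2r ?sqr_ge0// ler_norm.
Qed.

(** The two bounds on the gradient are compared at a unit vector and 0; in dimension 0 there is no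
    such pair and [L] may be negative. *)
Lemma modulus_le_lipschitz : (0 < n)%N -> mu <= L.
Proof.
case: n g g_cvx g_smooth => [//|n'] g' cvx smooth' _.
pose u : 'rV[R]_n'.+1 := delta_mx 0 0.
have nu : 0 < norm2 (u - 0).
  rewrite subr0 norm2_gt0; apply/eqP => /matrixP/(_ 0 0); rewrite !mxE/= => /eqP.
  by rewrite oner_eq0.
have := smooth'.2 u 0; have := dot_le_norm2 (gradient g' u - gradient g' 0) (u - 0).
have := cvx u 0; have := cvx 0 u; rewrite (norm2B 0 u).
set N := norm2 (u - 0) in nu *; set H := norm2 (_ - _).
rewrite !(dotBl, dotBr) => h1 h2 h3 h4.
have : mu * N ^+ 2 <= L * N * N by have := ler_wpM2r (ltW nu) h4; lra.
by rewrite -mulrA -expr2 ler_pM2r ?exprn_gt0.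
Qed.

(** Cocoercivity: [z] is a gradient step of length 1 / L from [x] for g minus its linear part at
    [y], a function minimal at [y]. The descent bound at [z] is compared with that minimum. *)
Lemma sqr_gradient_le_bregman x y : (0 < n)%N ->
  norm2 (G x - G y) ^+ 2 <= 2 * L * (g x - g y - dot (G y) (x - y)).
Proof.
move=> n0; have L0 : 0 < L := lt_le_trans mu0 (modulus_le_lipschitz n0).
have iL0 : 0 < L^-1 by rewrite invr_gt0.
pose d := G x - G y; pose z := x - L^-1 *: d.
have zx : z - x = - (L^-1 *: d) by rewrite /z addrC addKr.
have := descent_le x z; have := subgradient_le y z.
have -> : z - y = (z - x) + (x - y) by rewrite addrA subrK.
rewrite zx norm2N dotDr !dotNr !dotZr norm2Z (ger0_norm (ltW iL0)) exprMn.
rewrite -/d => h1 h2.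
have h3 : norm2 d ^+ 2 = dot (G x) d - dot (G y) d by rewrite sqr_norm2 /d -dotBl.
have h : norm2 d ^+ 2 / (2 * L) <= g x - g y - dot (G y) (x - y).
  have -> : norm2 d ^+ 2 / (2 * L) =
      L^-1 * dot (G x) d - L^-1 * dot (G y) d - L / 2 * (L^-1 ^+ 2 * norm2 d ^+ 2).
    by rewrite h3; field; rewrite gt_eqF.
  lra.
by move: h; rewrite ler_pdivrMr; [rewrite mulrC|lra].
Qed.

End SmoothStronglyConvex.

(** * Finitely generated cones *)

Lemma ler_fset_sum (R : realType) (T : choiceType) (V : {fset T}) (F : T -> R) a :
  (forall b, 0 <= F b) -> a \in V -> F a <= \sum_(b <- V) F b.
Proof. by move=> F0 aV; rewrite (big_fsetD1 a)//= lerDl sumr_ge0. Qed.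

(** A quantitative Caratheodory property of the cone generated by the rows: dependent rows allow
    arbitrarily large coefficients, but some choice is controlled by the norm of the point. *)
Definition conic_bounded (R : realType) (m N : nat) (A : 'M[R]_(m, N)) : Prop :=
  exists2 C : R, 0 <= C & forall c : 'rV[R]_m, (forall j, 0 <= c 0 j) ->
    exists c' : 'rV[R]_m, [/\ forall j, 0 <= c' 0 j, c' *m A = c *m A
      & forall j, c' 0 j <= C * norm2 (c *m A)].

(** With independent rows the coefficients are unique and depend linearly on the point through
    [pinvmx A]. *)
Lemma row_free_conic_bounded (R : realType) (m N : nat) (A : 'M[R]_(m, N)) :
  row_free A -> conic_bounded A.
Proof.
move=> freeA; exists (\sum_k \sum_j `|pinvmx A k j|).
  by do 2!apply: sumr_ge0 => ? _.
move=> c c0; exists c; split=> // j; rewrite -{1}(mulmxKp freeA c) mxE.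
rewrite mulr_suml; apply: ler_sum => k _.
rewrite (le_trans (ler_norm _))// normrM mulrC; apply: ler_pM => //.
  by rewrite (bigD1 j)//= lerDl sumr_ge0.
exact: ler_coord_norm2.
Qed.

(** Induction on the number of rows: a linear relation between them allows one coefficient to be
    cancelled. Which row is dropped depends on [c], so the constants of all possible deletions are
    added. *)
Lemma conic_caratheodory_mx (R : realType) (m N : nat) (A : 'M[R]_(m, N)) :
  conic_bounded A.
Proof.
elim: m A => [|m IH] A; have [/row_free_conic_bounded//|] := boolP (row_free A).
  by rewrite -row_leq_rank.
rewrite -kermx_eq0 => /rowV0Pn[z /sub_kermxP zA z0].
have {z z0 zA} [z [zA [j0 zj0]]] :
    exists z : 'rV[R]_m.+1, z *m A = 0 /\ exists j, 0 < z 0 j.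
  have [j zj] : exists j, z 0 j != 0.
    apply/existsP; apply: contraR z0; rewrite negb_exists => /forallP h.
    by apply/eqP/rowP => j; rewrite mxE; apply/eqP; have := h j; rewrite negbK.
  have [zj0|zj0] := ltP 0 (z 0 j); first by exists z; split=> //; exists j.
  exists (- z); split; first by rewrite mulNmx zA oppr0.
  by exists j; rewrite mxE oppr_gt0 lt_neqAle zj.
have /fin_all_exists2[C C0 CP] := fun j => IH (row' j A).
exists (\sum_j C j) => [|c c0]; first exact: sumr_ge0.
(* The smallest ratio is the largest multiple of [z] that can be subtracted from [c] while keeping
   all coefficients nonnegative; it cancels the coefficient at [j]. *)
pose j := [arg min_(j < j0 | 0 < z 0 j) (c 0 j / z 0 j)]%O.
have [zj jmin] : 0 < z 0 j /\ forall i, 0 < z 0 i -> c 0 j / z 0 j <= c 0 i / z 0 i.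
  by rewrite /j; case: arg_minP.
pose c1 := c - (c 0 j / z 0 j) *: z.
have c1A : c1 *m A = c *m A by rewrite mulmxBl -scalemxAl zA scaler0 subr0.
have c1_ge0 i : 0 <= c1 0 i.
  rewrite !mxE subr_ge0; have [zi|zi] := ltP 0 (z 0 i).
    by rewrite -ler_pdivlMr// jmin.
  by apply: le_trans (c0 i); rewrite mulr_ge0_le0// divr_ge0// ltW.
have c1j : c1 0 j = 0 by rewrite !mxE divfK ?gt_eqF// subrr.
have drop (a : 'rV[R]_m.+1) : a 0 j = 0 -> col' j a *m row' j A = a *m A.
  move=> aj; apply/rowP => k; rewrite !mxE [RHS](bigD1_ord j)//= aj mul0r add0r.
  by apply: eq_bigr => i _; rewrite !mxE.
have [i|c2 [c2_ge0 c2A c2C]] := CP j (col' j c1); first by rewrite mxE; exact: c1_ge0.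
pose c3 : 'rV[R]_m.+1 := \row_i if unlift j i is Some i' then c2 0 i' else 0.
have c3j : c3 0 j = 0 by rewrite mxE unlift_none.
have c3c2 : col' j c3 = c2 by apply/rowP => i; rewrite !mxE liftK.
exists c3; split=> [i||i].
- by rewrite mxE; case: unlift.
- by rewrite -drop// c3c2 c2A drop.
- have CS : C j <= \sum_j C j by rewrite (bigD1 j)//= lerDl; apply: sumr_ge0.
  rewrite mxE; case: unlift => [i'|]; last first.
    by apply: mulr_ge0; [exact: sumr_ge0|exact: norm2_ge0].
  apply: le_trans (c2C i') _; rewrite drop// c1A.
  by rewrite ler_wpM2r ?norm2_ge0.
Qed.

Section FsetWeights.
Variables (R : realType) (T : choiceType) (V : {fset T}).

Lemma big_fset_ord (M : nmodType) (F : T -> M) :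
  \sum_(a <- V) F a = \sum_(i < size V) F (tnth (in_tuple V) i).
Proof. by rewrite big_tnth. Qed.

(** The enumeration of [V] has no repetition, so the sum has at most one term; it extends the
    weights by 0 outside [V]. *)
Definition fset_weight (c : 'rV[R]_(size V)) (a : T) : R :=
  \sum_(i < size V | tnth (in_tuple V) i == a) c 0 i.

Lemma fset_weight_tnth c i : fset_weight c (tnth (in_tuple V) i) = c 0 i.
Proof.
rewrite /fset_weight (big_pred1 i)// => k /=.
have tinj : injective (tnth (in_tuple V)) by apply/tuple_uniqP; exact: fset_uniq.
exact: inj_eq tinj _ _.
Qed.

Lemma fset_weight_mulmx N (d : T -> 'rV[R]_N) (c : 'rV[R]_(size V)) :
  \sum_(a <- V) fset_weight c a *: d a =
    c *m \matrix_(i < size V) d (tnth (in_tuple V) i).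
Proof.
rewrite mulmx_sum_row big_fset_ord; apply: eq_bigr => i _.
by rewrite fset_weight_tnth rowK.
Qed.

Lemma fset_weight_row N (d : T -> 'rV[R]_N) (w : T -> R) :
  \sum_(a <- V) w a *: d a =
    (\row_i w (tnth (in_tuple V) i)) *m \matrix_(i < size V) d (tnth (in_tuple V) i).
Proof.
rewrite mulmx_sum_row big_fset_ord; apply: eq_bigr => i _.
by rewrite mxE rowK.
Qed.

Lemma conic_caratheodory N (d : T -> 'rV[R]_N) : exists C : R, 0 <= C /\
  forall w : T -> R, (forall a, a \in V -> 0 <= w a) ->
    exists w' : T -> R, [/\ forall a, 0 <= w' a,
      \sum_(a <- V) w' a *: d a = \sum_(a <- V) w a *: d a
      & forall a, a \in V -> w' a <= C * norm2 (\sum_(a <- V) w a *: d a)].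
Proof.
have [C C0 CP] := conic_caratheodory_mx (\matrix_(i < size V) d (tnth (in_tuple V) i)).
exists C; split=> // w w0.
have [i|c [c0 cA cC]] := CP (\row_i w (tnth (in_tuple V) i)).
  by rewrite mxE w0// mem_tnth.
exists (fset_weight c); split=> [a||a /(tnthP (in_tuple V))[i ->]].
- exact: sumr_ge0.
- by rewrite fset_weight_mulmx fset_weight_row.
- by rewrite fset_weight_tnth fset_weight_row.
Qed.

End FsetWeights.

(** One constant serves all subsets of [V]: the sum of their constants over the finite power set. *)
Lemma conic_caratheodory_sub (R : realType) (T : choiceType) (V : {fset T}) (N : nat)
    (d : T -> 'rV[R]_N) : exists2 C : R, 0 <= C &
  forall J : {fset T}, (J `<=` V)%fset ->
  forall w : T -> R, (forall a, a \in J -> 0 <= w a) ->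
    exists w' : T -> R, [/\ forall a, 0 <= w' a,
      \sum_(a <- J) w' a *: d a = \sum_(a <- J) w a *: d a
      & forall a, a \in J -> w' a <= C * norm2 (\sum_(a <- J) w a *: d a)].
Proof.
have [C CP] := choice (fun J : {fset T} => @conic_caratheodory R T J N d).
have C0 J : 0 <= C J by case: (CP J).
exists (\sum_(J <- fpowerset V) C J) => [|J JV w w0]; first exact: sumr_ge0.
have [_ /(_ w w0)[w' [w'0 w'E w'C]]] := CP J.
exists w'; split=> // a aJ; apply: le_trans (w'C a aJ) _.
by rewrite ler_wpM2r ?norm2_ge0// ler_fset_sum// fpowersetE.
Qed.

Lemma le0_of_quadratic (R : realType) (x y : R) : 0 <= y ->
  (forall t, 0 <= t <= 1 -> 0 <= t ^+ 2 * y - 2 * t * x) -> x <= 0.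
Proof.
move=> y0 h; rewrite leNgt; apply/negP => x0.
have xy : 0 < x + y by lra.
(* At t = x / (x + y) one has t y <= x, so t (t y - 2 x) is negative. *)
have /h : 0 <= x / (x + y) <= 1.
  by rewrite divr_ge0 ?(ltW x0) ?(ltW xy)//= ler_pdivrMr// mul1r lerDl.
have -> : (x / (x + y)) ^+ 2 * y - 2 * (x / (x + y)) * x =
    - (x ^+ 2 * (2 * x + y)) / (x + y) ^+ 2 by field; rewrite gt_eqF.
rewrite mulNr oppr_ge0 leNgt divr_gt0// ?exprn_gt0// mulr_gt0// ?exprn_gt0//; lra.
Qed.

Lemma continuous_sqr_dist_mulmx (R : realType) (m N : nat) (A : 'M[R]_(m, N))
    (r : 'rV[R]_N) :
  continuous (fun c : 'rV[R]_m => dot (r - c *m A) (r - c *m A)).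
Proof.
have cont_coord k : continuous (fun c : 'rV[R]_m => (r - c *m A) 0 k).
  have -> : (fun c : 'rV[R]_m => (r - c *m A) 0 k) =
      (fun c => r 0 k - \sum_j c 0 j * A j k) by apply/funext => c; rewrite !mxE.
  move=> c; apply: continuousB; first exact: cst_continuous.
  apply: (@continuous_big _ _ +%R 0 xpredT); first exact: add_continuous.
  move=> j _ {}c; apply: continuousM; last exact: cst_continuous.
  exact: coord_continuous.
rewrite /dot; apply: (@continuous_big _ _ +%R 0 xpredT); first exact: add_continuous.
by move=> k _ c; apply: continuousM; exact: cont_coord.
Qed.

(** Projection onto a finitely generated cone, by minimizing the distance over coefficients.
    [conic_caratheodory_mx] confines them to a compact box, and the conclusions are the first-order
    conditions. *)
Lemma cone_projection_mx (R : realType) (m N : nat) (A : 'M[R]_(m, N))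
    (r : 'rV[R]_N) :
  exists c : 'rV[R]_m, [/\ forall j, 0 <= c 0 j,
    forall j, dot (r - c *m A) (row j A) <= 0
    & dot (r - c *m A) (c *m A) = 0].
Proof.
have [C C0 CP] := conic_caratheodory_mx A.
pose f c := dot (r - c *m A) (r - c *m A).
pose b := C * (2 * norm2 r).
have b0 : 0 <= b by rewrite !mulr_ge0 ?norm2_ge0.
pose K : set 'rV[R]_m := [set c | forall i, `[0, b]%classic (c ord0 i)].
have K0 : K !=set0 by exists 0 => i /=; rewrite mxE in_itv/= lexx.
have Kc : compact K.
  by apply: (@rV_compact R m (fun=> `[0, b]%classic)) => i; exact: segment_compact.
have fK : {within K, continuous f}.
  by apply: continuous_subspaceT; exact: continuous_sqr_dist_mulmx.
have [c cK cmin] := compact_EVT_min K0 Kc fK.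
rewrite inE in cK.
have c0 j : 0 <= c 0 j by have := cK j; rewrite /= in_itv/= => /andP[].
have gmin (c' : 'rV[R]_m) : (forall j, 0 <= c' 0 j) -> f c <= f c'.
  move=> c'0; have [le2|lt2] := leP (norm2 (c' *m A)) (2 * norm2 r).
    have [c'' [c''0 e c''C]] := CP c' c'0.
    have -> : f c' = f c'' by rewrite /f e.
    apply: cmin; rewrite inE => j /=; rewrite in_itv/= c''0/=.
    by apply: le_trans (c''C j) _; rewrite ler_wpM2l.
  (* A point of norm above [2 * norm2 r] is farther from [r] than the apex 0 is. *)
  apply: (@le_trans _ _ (f 0)).
    by apply: cmin; rewrite inE => j /=; rewrite mxE in_itv/= lexx.
  rewrite /f mul0mx subr0 -!sqr_norm2 ler_sqr ?nnegrE ?norm2_ge0//.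
  have := ler_norm2D (c' *m A - r) r; rewrite subrK norm2B; lra.
have [q qE] : exists q, r - c *m A = q by exists (r - c *m A).
have variation (v : 'rV[R]_m) : (forall j, 0 <= (c + v) 0 j) -> dot q (v *m A) <= 0.
  move=> cv; apply: (@le0_of_quadratic _ _ _ (dot_ge0 (v *m A))) => t /andP[t0 t1].
  have ct j : 0 <= (c + t *: v) 0 j.
    have -> : c + t *: v = (1 - t) *: c + t *: (c + v).
      by rewrite scalerDr addrA -scalerDl subrK scale1r.
    by rewrite 3!mxE addr_ge0// ?mulr_ge0 ?subr_ge0// -mxE.
  have := gmin _ ct; rewrite /f mulmxDl -scalemxAl opprD addrA qE.
  rewrite !(dotBl, dotBr, dotZl, dotZr) (dotC (v *m A) q); lra.
exists c; rewrite qE; split=> // [j|].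
- by rewrite rowE; apply: variation => k; rewrite !mxE addr_ge0.
(* Scaling the projection up and down, that is varying along [c] and [- c], gives both
   inequalities. *)
- apply/eqP; rewrite eq_le variation => [|j]; last by rewrite mxE addr_ge0.
  rewrite -oppr_le0 -dotNr -mulNmx variation// => j.
  by rewrite subrr mxE.
Qed.

Lemma cone_projection (R : realType) (T : choiceType) (V : {fset T}) (N : nat)
    (d : T -> 'rV[R]_N) (r : 'rV[R]_N) :
  exists w : T -> R, let r' := \sum_(a <- V) w a *: d a in
    [/\ forall a, 0 <= w a, forall a, a \in V -> dot (r - r') (d a) <= 0
      & dot (r - r') r' = 0].
Proof.
pose A := \matrix_(i < size V) d (tnth (in_tuple V) i).
have [c [c0 cA cc]] := cone_projection_mx A r.
exists (fset_weight c) => /=; rewrite fset_weight_mulmx -/A; split=> // [a|a].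
  exact: sumr_ge0.
by move=> /(tnthP (in_tuple V))[i ->]; have := cA i; rewrite rowK.
Qed.

(** * Convex hulls, faces and the pyramidal width *)

Lemma sum_fsetM (M : nmodType) (T U : choiceType) (A : {fset T}) (B : {fset U})
    (F : T -> U -> M) :
  \sum_(p <- (A `*` B)%fset) F p.1 p.2 = \sum_(a <- A) \sum_(b <- B) F a b.
Proof.
transitivity (\sum_(p <- [seq (a, b) | a <- A, b <- B]) F p.1 p.2); last first.
  by rewrite big_allpairs.
apply: perm_big; apply: uniq_perm => [||[a b]]; first exact: fset_uniq.
  by apply: allpairs_uniq => // -[a b] [c d] _ _ [-> ->].
rewrite in_fsetM; apply/andP/allpairsP => [[aA bB]|[[c d] [cA dB [-> ->]]]] //.
by exists (a, b).
Qed.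

Lemma sum_fset_const (R : realType) (T : choiceType) (V : {fset T}) (c : R) :
  \sum_(a <- V) c = #|` V|%:R * c.
Proof. by rewrite big_const_seq count_predT iter_addr addr0 mulr_natl. Qed.

Section ConvHull.
Variables (R : realType) (m : nat) (V : {fset 'rV[R]_m}).
Implicit Types (S : {fset 'rV[R]_m}) (K : set 'rV[R]_m) (u v r : 'rV[R]_m).

Lemma mem_conv_hull a : a \in V -> conv_hull V a.
Proof.
move=> aV; exists (fun b => (b == a)%:R); split=> [b _||].
- exact: ler0n.
- rewrite (big_fsetD1 a)//= eqxx big_seq big1 ?addr0// => b.
  by rewrite !inE => /andP[/negPf->].
- rewrite (big_fsetD1 a)//= eqxx scale1r big_seq big1 ?addr0// => b.
  by rewrite !inE => /andP[/negPf->]; rewrite scale0r.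
Qed.

Lemma conv_hull_convex u v (t : R) : 0 <= t <= 1 ->
  conv_hull V u -> conv_hull V v -> conv_hull V (t *: u + (1 - t) *: v).
Proof.
move=> /andP[t0 t1] [w [w0 w1 ->]] [w' [w'0 w'1 ->]].
exists (fun a => t * w a + (1 - t) * w' a); split=> [a aV||].
- by rewrite addr_ge0// mulr_ge0 ?subr_ge0 ?w0 ?w'0.
- by rewrite big_split/= -!mulr_sumr w1 w'1; ring.
- rewrite !scaler_sumr -big_split/=; apply: eq_bigr => a _.
  by rewrite !scalerA scalerDl.
Qed.

Lemma conv_hull_dot_le r (c : R) u : (forall a, a \in V -> dot r a <= c) ->
  conv_hull V u -> dot r u <= c.
Proof.
move=> h [w [w0 w1 ->]]; rewrite dot_sumr -[leRHS]mul1r -w1 mulr_suml.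
by rewrite big_seq [leRHS]big_seq; apply: ler_sum => a aV; rewrite dotZr ler_wpM2l ?w0 ?h.
Qed.

Lemma proper_comb_conv_hull S u : (S `<=` V)%fset -> proper_comb S u -> conv_hull V u.
Proof.
move=> SV [w [w0 w1 ->]]; exists (fun a => if a \in S then w a else 0); split.
- by move=> a _; case: ifP => // /w0/ltW.
- rewrite -(big_fset_incl _ SV) => [|a _ /negPf->//].
  by rewrite -w1 big_seq [RHS]big_seq; apply: eq_bigr => a ->.
- rewrite -(big_fset_incl _ SV) => [|a _ /negPf->]; last exact: scale0r.
  by rewrite big_seq [RHS]big_seq; apply: eq_bigr => a ->.
Qed.

Lemma conv_hull_proper_comb u : conv_hull V u ->
  exists2 S, (S `<=` V)%fset & proper_comb S u.
Proof.
move=> [w [w0 w1 ->]]; pose S := [fset a in V | 0 < w a]%fset.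
have SV : (S `<=` V)%fset by apply/fsubsetP => a; rewrite !inE => /andP[].
have wS a : a \in V -> a \notin S -> w a = 0.
  move=> aV; rewrite !inE aV/= -leNgt => wa.
  by apply/eqP; rewrite eq_le wa w0.
exists S => //; exists w; split=> [a||].
- by rewrite !inE => /andP[].
- by rewrite -w1; exact: big_fset_incl.
- by symmetry; apply: big_fset_incl => // a aV /wS->//; rewrite scale0r.
Qed.

Lemma proper_comb_neq0 S u : proper_comb S u -> exists s, s \in S.
Proof.
move=> [w [_ w1 _]]; apply/fset0Pn; apply/negP => /eqP S0.
by move: w1; rewrite S0 big_seq_fset0 => /eqP; rewrite eq_sym oner_eq0.
Qed.

Lemma conv_hull_neq0 u : conv_hull V u -> exists a, a \in V.
Proof.
move=> /conv_hull_proper_comb[S SV /proper_comb_neq0[s sS]].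
by exists s; exact: (fsubsetP SV).
Qed.

Lemma norm2_conv_hull_le u : conv_hull V u -> norm2 u <= \sum_(a <- V) norm2 a.
Proof.
move=> [w [w0 w1 ->]]; apply: le_trans (ler_norm2_sum _ _ _) _.
rewrite big_seq [leRHS]big_seq; apply: ler_sum => a aV.
rewrite norm2Z ger0_norm ?w0// ler_piMl ?norm2_ge0//.
rewrite -w1 (big_fsetD1 a)//= lerDl big_seq sumr_ge0// => b.
by rewrite !inE => /andP[_ /w0].
Qed.

Lemma conv_hull_face : is_face (conv_hull V) (conv_hull V).
Proof.
split=> // u v t; rewrite !inE => uV vV.
by apply: conv_hull_convex => //; rewrite ge0/=; exact: le1.
Qed.

(** The functional is at most 0 on the hull, so a combination with weights in (0, 1) reaches 0 only
    if both of its points do. *)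
Lemma exposed_face q u : conv_hull V u ->
  (forall a, a \in V -> dot q (a - u) <= 0) ->
  is_face (conv_hull V) [set y | conv_hull V y /\ dot q (y - u) = 0].
Proof.
move=> uV qV; have qle y : conv_hull V y -> dot q (y - u) <= 0.
  move=> yV; rewrite dotBr subr_le0; apply: conv_hull_dot_le yV => a /qV.
  by rewrite dotBr subr_le0.
have expand y z (t : R) : dot q (t *: y + (1 - t) *: z - u) =
    t * dot q (y - u) + (1 - t) * dot q (z - u).
  by rewrite !(dotBr, dotDr, dotZr); ring.
split=> [y []//|y z t|y z t yV zV /andP[t0 t1]].
- rewrite !inE => -[yV y0] [zV z0]; split.
    by apply: conv_hull_convex => //; rewrite ge0/=; exact: le1.
  by rewrite [LHS]expand y0 z0 !mulr0 addr0.
- move=> [_ /eqP]; rewrite expand.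
  have y0 := qle _ yV; have z0 := qle _ zV.
  have h1 : t * dot q (y - u) <= 0 by rewrite pmulr_rle0.
  have h2 : (1 - t) * dot q (z - u) <= 0 by rewrite pmulr_rle0 ?subr_gt0.
  rewrite naddr_eq0// => /andP[]; rewrite !mulf_eq0 subr_eq0 (gt_eqF t0) (gt_eqF t1)/=.
  by move=> /eqP-> /eqP->.
Qed.

(** Isolating [s] writes [u] as a strict combination of [s] and the renormalized rest, to which the
    face property applies. For a singleton there is no rest and u = s. *)
Lemma face_proper_comb K S u : is_face (conv_hull V) K -> K u ->
  (S `<=` V)%fset -> proper_comb S u -> forall s, s \in S -> K s.
Proof.
move=> [KC _ Kface] Ku SV [w [w0 w1 uE]] s sS.
have sV : s \in V by exact: (fsubsetP SV).
have [S1|/fset0Pn[b bS]] := eqVneq (S `\ s)%fset fset0.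
  move: w1 uE; rewrite !(big_fsetD1 s sS)/= S1 !big_seq_fset0 !addr0 => ->.
  by rewrite scale1r => <-.
pose t := w s; pose S' := (S `\ s)%fset.
have S'S : (S' `<=` S)%fset by exact: fsubD1set.
have w'0 a : a \in S' -> 0 < w a by move=> /(fsubsetP S'S)/w0.
have t1E : \sum_(a <- S') w a = 1 - t.
  by rewrite -w1 [in RHS](big_fsetD1 s)//= [RHS]addrAC subrr add0r.
have t1 : 0 < 1 - t.
  rewrite -t1E (big_fsetD1 b)//=; apply: ltr_pwDl; first exact: w'0.
  by rewrite big_seq; apply: sumr_ge0 => a; rewrite !inE => /andP[_ aS]; rewrite ltW// w'0// !inE.
pose y := \sum_(a <- S') ((1 - t)^-1 * w a) *: a.
have yV : conv_hull V y.
  apply: (@proper_comb_conv_hull S'); first exact: fsubset_trans SV.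
  exists (fun a => (1 - t)^-1 * w a); split=> // [a aS|].
    by rewrite mulr_gt0 ?invr_gt0 ?w'0.
  by rewrite -mulr_sumr t1E mulVf ?gt_eqF.
have t01 : 0 < t < 1 by rewrite w0//=; lra.
suff yE : t *: s + (1 - t) *: y = u.
  by have := Kface s y t (mem_conv_hull sV) yV t01; rewrite yE => /(_ Ku)[].
rewrite uE (big_fsetD1 s)//=; congr (_ + _).
rewrite /y scaler_sumr; apply: eq_bigr => a _.
by rewrite scalerA mulrA divff ?gt_eqF// mul1r.
Qed.

End ConvHull.

(** The bound [c] ensures that the [sup] defining the diameter is a true supremum. *)
Lemma le_diameter (R : realType) (m : nat) (A : set 'rV[R]_m) (c : R) u v :
  (forall w, A w -> norm2 w <= c) -> A u -> A v -> norm2 (u - v) <= diameter A.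
Proof.
move=> Ac Au Av; apply: ub_le_sup; last by exists u => //; exists v.
exists (c + c) => _ [p Ap [q Aq <-]].
by apply: le_trans (ler_norm2B _ _) _; rewrite lerD ?Ac.
Qed.

Section PyramidalWidth.
Variables (R : realType) (m : nat) (V : {fset 'rV[R]_m}).
Implicit Types (A S : {fset 'rV[R]_m}) (K : set 'rV[R]_m) (r u : 'rV[R]_m).

Local Notation unit r := ((norm2 r)^-1 *: r).
Local Notation widths A S r := [set dot (unit r) (a - s) | a in [set` A] & s in [set` S]].

Lemma dot_unit r v : dot (unit r) v = dot r v / norm2 r.
Proof. by rewrite dotZl mulrC. Qed.

Lemma has_ubound_widths A S r : has_ubound (widths A S r).
Proof.
exists (\sum_(a <- A) `|dot (unit r) a| + \sum_(s <- S) `|dot (unit r) s|).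
move=> _ [a aA [s sS <-]]; rewrite dotBr; apply: lerD.
  by apply: le_trans (ler_norm _) _; exact: (ler_fset_sum (fun=> normr_ge0 _)).
apply: le_trans (ler_norm _) _; rewrite normrN.
exact: (ler_fset_sum (fun=> normr_ge0 _)).
Qed.

Lemma sup_widths_ge0 A S r u : (S `<=` A)%fset -> proper_comb S u ->
  0 <= sup (widths A S r).
Proof.
move=> SA /proper_comb_neq0[s sS]; apply: ub_le_sup; first exact: has_ubound_widths.
exists s; first exact: (fsubsetP SA).
by exists s => //; rewrite subrr dot0r.
Qed.

Lemma PdirW_ge0 A r u : 0 <= PdirW A r u.
Proof.
rewrite /PdirW; set E := [set _ | _ in _].
have [->|/set0P E0] := eqVneq E set0; first by rewrite inf0.
apply: lb_le_inf => // _ [S [SA Su] <-]; exact: sup_widths_ge0 Su.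
Qed.

Lemma PWidth_ge0 : 0 <= PWidth V.
Proof.
rewrite /PWidth; set E := [set _ | _].
have [->|/set0P E0] := eqVneq E set0; first by rewrite inf0.
by apply: lb_le_inf => // _ [K [u [r [_ _ _ _ ->]]]]; exact: PdirW_ge0.
Qed.

Lemma PWidth_le_sup K u r S : is_face (conv_hull V) K -> K u ->
  cone [set z - u | z in K] r -> r != 0 ->
  (S `<=` [fset a in V | a \in K])%fset -> proper_comb S u ->
  PWidth V <= sup (widths [fset a in V | a \in K]%fset S r).
Proof.
move=> Kf Ku Kr r0 SA Su.
apply: (@le_trans _ _ (PdirW [fset a in V | a \in K]%fset r u)).
  apply: ge_inf; last by exists K, u, r.
  by exists 0 => _ [K' [u' [r' [_ _ _ _ ->]]]]; exact: PdirW_ge0.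
apply: ge_inf; last by exists S.
by exists 0 => _ [S' [S'A S'u] <-]; exact: sup_widths_ge0 S'u.
Qed.

Lemma face_fset K S u : is_face (conv_hull V) K -> K u ->
  (S `<=` V)%fset -> proper_comb S u -> (S `<=` [fset a in V | a \in K])%fset.
Proof.
move=> Kf Ku SV Su; apply/fsubsetP => s sS; rewrite !inE (fsubsetP SV)//=.
by apply/mem_set; exact: (face_proper_comb Kf Ku SV Su).
Qed.

(* With [q] the residual of [r] after projection to the cone generated by
   [V - u], the face on which [q] is maximal contains [S], the projection is a
   feasible direction of that face, and [q] is constant on it. *)
Lemma PWidth_dot_le S u y r (G : R) : (S `<=` V)%fset -> proper_comb S u ->
  conv_hull V y -> 0 < dot r (y - u) ->
  (forall a s, a \in V -> s \in S -> dot r (a - s) <= G) ->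
  PWidth V * dot r (y - u) <= G * norm2 (y - u).
Proof.
move=> SV Su yV ry GP; have uV := proper_comb_conv_hull SV Su.
have [w /= [w0 qV qr']] := cone_projection V (fun a => a - u) r.
have [r' r'E] : exists r', \sum_(a <- V) w a *: (a - u) = r' by eexists.
rewrite r'E in qV qr'.
have [q qE] : exists q, r - r' = q by eexists.
rewrite qE in qV qr'; have rE : r = r' + q by rewrite -qE addrC subrK.
have qle v : conv_hull V v -> dot q (v - u) <= 0.
  move=> vV; rewrite dotBr subr_le0; apply: conv_hull_dot_le vV => a /qV.
  by rewrite dotBr subr_le0.
have r'y : dot r (y - u) <= dot r' (y - u).
  by rewrite rE dotDl gerDl qle.
have r'0 : r' != 0.
  by apply: contraTneq ry => r'0; rewrite -leNgt (le_trans r'y)// r'0 dot0l.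
have nr' : 0 < norm2 r' by rewrite norm2_gt0.
pose W := \sum_(a <- V) w a.
have W0 : 0 < W.
  rewrite lt_neqAle sumr_ge0// andbT eq_sym; apply: contra r'0.
  rewrite psumr_eq0// => /allP wE; rewrite -r'E big_seq big1// => a /wE/eqP->.
  by rewrite scale0r.
(* Normalizing the coefficients of the projection gives r' = W (z - u) with [z] in the hull. *)
pose z := \sum_(a <- V) (W^-1 * w a) *: a.
have zV : conv_hull V z.
  exists (fun a => W^-1 * w a); split=> // [a _|].
    by rewrite mulr_ge0// invr_ge0 ltW.
  by rewrite -mulr_sumr mulVf// gt_eqF.
have r'z : r' = W *: (z - u).
  rewrite -r'E scalerBr /z scaler_sumr scaler_suml -sumrB.
  by apply: eq_bigr => a _; rewrite scalerA mulrA divff ?gt_eqF// mul1r scalerBr.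
pose K : set 'rV[R]_m := [set v | conv_hull V v /\ dot q (v - u) = 0].
have Kf : is_face (conv_hull V) K by exact: exposed_face.
have Ku : K u by split=> //; rewrite subrr dot0r.
have Kz : K z.
  split=> //; move/eqP: qr'; rewrite r'z dotZr mulf_eq0 gt_eqF//=.
  by move/eqP.
have SA := face_fset Kf Ku SV Su.
have Kr' : cone [set v - u | v in K] r'.
  by exists W => /=; [exact: ltW|exists (z - u); [exists z|]].
have width_le : PWidth V <= G / norm2 r'.
  apply: le_trans (PWidth_le_sup Kf Ku Kr' r'0 SA Su) _.
  have [s sS] := proper_comb_neq0 Su.
  apply: ge_sup.
    by exists (dot (unit r') (s - s)), s; [exact: (fsubsetP SA)|exists s].
  move=> _ [a aA [s' s'S <-]]; rewrite dot_unit ler_pM2r ?invr_gt0//.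
  move: aA; rewrite /= !inE => /andP[aV /set_mem[_ qa]].
  have := fsubsetP SA _ s'S; rewrite !inE => /andP[_ /set_mem[_ qs]].
  have -> : dot r' (a - s') = dot r (a - s').
    have : dot q (a - s') = dot q (a - u) - dot q (s' - u) by rewrite !dotBr; ring.
    by rewrite qa qs subr0 rE dotDl => ->; rewrite addr0.
  exact: GP.
have := PWidth_ge0; set gam := PWidth V in width_le * => gam0.
have G0 : gam * norm2 r' <= G by rewrite -ler_pdivlMr.
apply: (@le_trans _ _ (gam * (norm2 r' * norm2 (y - u)))).
  by rewrite ler_wpM2l// (le_trans r'y)// dot_le_norm2.
by rewrite mulrA ler_wpM2r ?norm2_ge0.
Qed.

(** The width is tested on the whole hull, at u = a with S = {a} and direction b - a. *)
Lemma PWidth_le_diameter (a b : 'rV[R]_m) : a \in V -> b \in V -> a != b ->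
  PWidth V <= diameter (conv_hull V).
Proof.
move=> aV bV ab.
have Vf := conv_hull_face V.
have SV : ([fset a] `<=` V)%fset by rewrite fsub1set.
have Sa : proper_comb [fset a]%fset a.
  by exists (fun=> 1); split=> //; rewrite big_seq_fset1// scale1r.
have ba0 : b - a != 0 by rewrite subr_eq0 eq_sym.
have aK := mem_conv_hull aV.
have SA := face_fset Vf aK SV Sa.
apply: le_trans (PWidth_le_sup Vf aK _ ba0 SA Sa) _.
  exists 1 => /=; [exact: ler01|exists (b - a); last by rewrite scale1r].
  by exists b => //; exact: mem_conv_hull.
apply: ge_sup.
  exists (dot (unit (b - a)) (a - a)), a; last by exists a; rewrite /= ?inE.
  by apply: (fsubsetP SA); rewrite inE.
move=> _ [c cA [s /= sS <-]]; move: cA; rewrite /= !inE => /andP[cV _].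
move: sS; rewrite inE => /eqP->.
apply: le_trans (dot_le_norm2 _ _) _.
rewrite norm2Z ger0_norm ?invr_ge0 ?norm2_ge0// mulVf ?norm2_eq0// mul1r.
exact: le_diameter (@norm2_conv_hull_le _ _ V) (mem_conv_hull cV) aK.
Qed.

Lemma dot_sup_widths_le A S r a s : r != 0 -> a \in A -> s \in S ->
  dot r (a - s) <= norm2 r * sup (widths A S r).
Proof.
move=> r0 aA sS; rewrite mulrC -ler_pdivrMr ?norm2_gt0// -dot_unit.
by apply: ub_le_sup; [exact: has_ubound_widths|exists a => //; exists s].
Qed.

(* The feasible directions of a face at [u] lie in the cone generated by the
   differences [a - s], so their squared norm is a nonnegative combination of
   the numbers [dot r (a - s)] with coefficients bounded by a multiple of their
   norm; only finitely many such cones occur. *)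
Lemma PWidth_gt0 (a b : 'rV[R]_m) : a \in V -> b \in V -> a != b -> 0 < PWidth V.
Proof.
move=> aV bV ab.
pose d (p : 'rV[R]_m * 'rV[R]_m) := p.1 - p.2.
have [B B0 BP] := conic_caratheodory_sub (V `*` V)%fset d.
pose k : R := #|` (V `*` V)%fset|%:R.
have kB : 0 < 1 + k * B by rewrite ltr_pwDl// mulr_ge0.
(* For each width [M] the argument ends with 1 <= k B M; adding 1 keeps the denominator positive. *)
apply: (@lt_le_trans _ _ (1 + k * B)^-1); first by rewrite invr_gt0.
apply: lb_le_inf.
  (* The infimum must be shown to range over a nonempty set, since it would otherwise be 0 by
     default. *)
  exists (PdirW [fset c in V | c \in conv_hull V]%fset (b - a) a).
  exists (conv_hull V), a, (b - a); split=> //; first exact: conv_hull_face.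
  - exact: mem_conv_hull.
  - exists 1 => /=; [exact: ler01|exists (b - a); last by rewrite scale1r].
    by exists b => //; exact: mem_conv_hull.
  - by rewrite subr_eq0 eq_sym.
move=> _ [K [u [r [Kf Ku Kr r0 ->]]]]; have KV : K `<=` conv_hull V by case: Kf.
set A := [fset c in V | c \in K]%fset.
have AV : (A `<=` V)%fset by apply/fsubsetP => c; rewrite !inE => /andP[].
apply: lb_le_inf.
  have [S SV Su] := conv_hull_proper_comb (KV _ Ku).
  by exists (sup (widths A S r)), S => //; split=> //; exact: face_fset Su.
move=> _ [S [SA Su] <-]; set M := sup _.
have M0 : 0 <= M by exact: sup_widths_ge0 Su.
have [t /= t0 [_ [z Kz <-] rE]] := Kr.
have [S' S'V S'z] := conv_hull_proper_comb (KV _ Kz).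
have [l [l0 l1 zE]] : conv_hull A z.
  by apply: (proper_comb_conv_hull _ S'z); exact: (face_fset Kf Kz).
have [w [w0 w1 uE]] : conv_hull S u by exact: proper_comb_conv_hull Su.
pose J := (A `*` S)%fset.
have JV : (J `<=` V `*` V)%fset.
  apply/fsubsetP => p; rewrite !in_fsetM => /andP[/(fsubsetP AV)->].
  by move=> /(fsubsetP SA)/(fsubsetP AV)->.
have cu (c : 'rV[R]_m) : c - u = \sum_(s <- S) w s *: (c - s).
  rewrite uE -{1}[c]scale1r -w1 scaler_suml -sumrB.
  by apply: eq_bigr => s _; rewrite scalerBr.
have rJ : r = \sum_(p <- J) (t * (l p.1 * w p.2)) *: d p.
  rewrite (sum_fsetM A S (fun a s => (t * (l a * w s)) *: (a - s))) -rE.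
  rewrite -[u]scale1r -l1 scaler_suml zE -sumrB scaler_sumr.
  apply: eq_bigr => c _; rewrite -scalerBr cu !scaler_sumr.
  by apply: eq_bigr => s _; rewrite !scalerA mulrA.
have [|w' [w'0 w'E w'C]] := BP J JV (fun p => t * (l p.1 * w p.2)).
  by move=> p; rewrite in_fsetM => /andP[/l0 ? /w0 ?]; rewrite !mulr_ge0.
rewrite -rJ in w'E w'C.
have nr : 0 < norm2 r by rewrite norm2_gt0.
have le_r : norm2 r ^+ 2 <= k * B * M * norm2 r ^+ 2.
  rewrite {1}sqr_norm2 -{1}w'E dot_suml.
  apply: (@le_trans _ _ (\sum_(p <- J) B * M * norm2 r ^+ 2)); last first.
    rewrite sum_fset_const !mulrA !ler_wpM2r// ?norm2_ge0 ?ler_nat//.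
    exact: fsubset_leq_card.
  rewrite big_seq [leRHS]big_seq; apply: ler_sum => p pJ; rewrite dotZl dotC.
  move: (pJ); rewrite in_fsetM => /andP[pA pS].
  apply: le_trans (ler_wpM2l (w'0 p) (dot_sup_widths_le r0 pA pS)) _.
  rewrite -/M [leRHS](_ : _ = B * norm2 r * (norm2 r * M)); last by ring.
  by rewrite ler_wpM2r ?w'C// mulr_ge0// norm2_ge0.
move: le_r; rewrite -{1}[norm2 r ^+ 2]mul1r ler_pM2r ?exprn_gt0// => le1.
by rewrite -div1r ler_pdivrMr//; lra.
Qed.

End PyramidalWidth.

(** * Maxima of affine functions *)

Section MaxAffine.
Variables (R : realType) (n : nat).
Implicit Types (V W S : {fset 'rV[R]_(n + 1)}) (p q u : 'rV[R]_(n + 1)).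
Implicit Types (x y : 'rV[R]_n) (g : 'rV[R]_n -> R).

Lemma dot_row_mx (m1 m2 : nat) (a c : 'rV[R]_m1) (b d : 'rV[R]_m2) :
  dot (row_mx a b) (row_mx c d) = dot a c + dot b d.
Proof.
rewrite /dot big_split_ord/=; congr (_ + _); apply: eq_bigr => i _.
  by rewrite !row_mxEl.
by rewrite !row_mxEr.
Qed.

(** Homogenization turns evaluation of cuts at [x] into a linear functional on R^(n + 1), the space
    in which the width of [V] lives. *)
Definition homog x : 'rV[R]_(n + 1) := row_mx x (const_mx 1).

Lemma affine_dot p x : affine p x = dot p (homog x).
Proof.
rewrite -[p in RHS]hsubmxK dot_row_mx /affine; congr (_ + _).
by rewrite /dot big_ord1 [const_mx 1 0 0]mxE mulr1.
Qed.

Lemma dot_slope_offset u v :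
  dot u v = dot (slope u) (slope v) + offset u * offset v.
Proof. by rewrite -[u in LHS]hsubmxK -[v in LHS]hsubmxK dot_row_mx /dot big_ord1. Qed.

Lemma slopeB u v : slope (u - v) = slope u - slope v.
Proof. by apply/rowP => i; rewrite !mxE. Qed.

Lemma norm2_slope_le u : norm2 (slope u) <= norm2 u.
Proof.
rewrite -(@ler_sqr R) ?nnegrE ?norm2_ge0// !sqr_norm2 (dot_slope_offset u) lerDl.
by rewrite -expr2 sqr_ge0.
Qed.

Lemma affine_sum V (w : 'rV[R]_(n + 1) -> R) x :
  affine (\sum_(p <- V) w p *: p) x = \sum_(p <- V) w p * affine p x.
Proof. by rewrite affine_dot dot_suml; apply: eq_bigr => p _; rewrite dotZl affine_dot. Qed.

Lemma affine_shift p x y : affine p y = affine p x + dot (slope p) (y - x).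
Proof. by rewrite /affine dotBr; ring. Qed.

Lemma affine_le_max V p x : p \in V -> affine p x <= max_affine V x.
Proof.
move=> pV; apply: ub_le_sup; last by exists p.
exists (\sum_(q <- V) `|affine q x|) => _ [q qV <-].
by apply: le_trans (ler_norm _) _; exact: (ler_fset_sum (fun=> normr_ge0 _)).
Qed.

Lemma max_affine_le V x (c : R) : V != fset0%fset ->
  (forall p, p \in V -> affine p x <= c) -> max_affine V x <= c.
Proof.
move=> /fset0Pn[p pV] h; apply: ge_sup; first by exists (affine p x), p.
by move=> _ [q qV <-]; exact: h.
Qed.

Lemma max_affine_attained V x : V != fset0%fset ->
  exists2 p, p \in V & affine p x = max_affine V x.
Proof.
move=> V0; have /fset0Pn[p pV] := V0.
have [q _ qmax] := @arg_maxP _ _ V [` pV]%fset xpredT (fun q : V => affine (val q) x) isT.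
exists (val q); first exact: valP.
apply/le_anti; rewrite affine_le_max ?(valP q)//= max_affine_le// => r rV.
exact: (qmax [` rV]%fset).
Qed.

Lemma max_affine_sub V W x : W != fset0%fset -> (W `<=` V)%fset ->
  max_affine W x <= max_affine V x.
Proof.
move=> W0 WV; apply: max_affine_le => // p pW.
by apply: affine_le_max; exact: (fsubsetP WV).
Qed.

Lemma conv_hull_affine_le V u x : conv_hull V u -> affine u x <= max_affine V x.
Proof.
move=> uV; rewrite affine_dot dotC; apply: conv_hull_dot_le uV => a aV.
by rewrite dotC -affine_dot affine_le_max.
Qed.

Lemma proper_comb_affine_eq S u x (c : R) : proper_comb S u ->
  (forall s, s \in S -> affine s x = c) -> affine u x = c.
Proof.
move=> [w [_ w1 ->]] h; rewrite affine_sum -[RHS]mul1r -w1 mulr_suml.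
by rewrite big_seq [RHS]big_seq; apply: eq_bigr => s /h->.
Qed.

(** Along the ray spanned by [slope p] the cut [p] grows at rate [norm2 (slope p)]; a smaller
    Lipschitz constant fails far enough out. The constant [B] shows that the infimum is over a
    nonempty set. *)
Lemma norm2_slope_le_lipschitz V p : p \in V ->
  norm2 (slope p) <= lipschitz_const (max_affine V).
Proof.
move=> pV; have V0 : V != fset0%fset by apply/fset0Pn; exists p.
pose B := \sum_(q <- V) norm2 (slope q).
have half x y : max_affine V x - max_affine V y <= B * norm2 (x - y).
  have [q qV <-] := max_affine_attained x V0.
  rewrite (affine_shift q y x); have := affine_le_max y qV => h.
  apply: (@le_trans _ _ (dot (slope q) (x - y))); first lra.
  apply: le_trans (dot_le_norm2 _ _) _; rewrite ler_wpM2r ?norm2_ge0//.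
  exact: (ler_fset_sum (fun r => norm2_ge0 (slope r))).
apply: lb_le_inf.
  exists B; split=> [|x y]; first by apply: sumr_ge0 => q _; exact: norm2_ge0.
  by rewrite ler_norml half andbT lerNl opprB norm2B half.
move=> M [M0 lip]; rewrite leNgt; apply/negP => MN.
set N := norm2 (slope p) in MN.
have N0 : 0 < N by exact: le_lt_trans MN.
pose f0 := max_affine V 0.
have NM : 0 < N * (N - M) by rewrite mulr_gt0// subr_gt0.
pose t := (`|f0 - offset p| + 1) / (N * (N - M)).
have t0 : 0 < t by rewrite divr_gt0// ltr_wpDl.
have := affine_le_max (t *: slope p) pV.
have := le_trans (ler_norm _) (lip (t *: slope p) 0).
rewrite subr0 norm2Z (gtr0_norm t0) /affine dotZr -sqr_norm2 -/N -/f0 => h1 h2.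
have h3 : t * (N * (N - M)) = `|f0 - offset p| + 1 by rewrite divfK ?gt_eqF.
have := ler_norm (f0 - offset p); nra.
Qed.

(* If [-gradient g x] is not a convex combination of the active slopes, the
   residual of its homogenization after projection to the cone generated by the
   homogenized active slopes is a direction of strict descent. *)
Lemma minimizer_slope g (c : R) W x : W != fset0%fset ->
  (forall y, g y <= g x + dot (gradient g x) (y - x) + c * norm2 (y - x) ^+ 2) ->
  minimizer (fun y => g y + max_affine W y) x ->
  exists S u, [/\ (S `<=` W)%fset, proper_comb S u, slope u = - gradient g x
    & forall q, q \in S -> affine q x = max_affine W x].
Proof.
move=> W0 gup xmin; set G := gradient g x in gup *.
set F := max_affine W x.
pose Act := [fset q in W | affine q x == F]%fset.
have [w /= [w0 wAct wr]] := cone_projection Act (fun q => homog (slope q)) (homog (- G)).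
have [r' r'E] : exists r', \sum_(q <- Act) w q *: homog (slope q) = r' by eexists.
rewrite r'E in wAct wr.
have [rho rhoE] : exists rho, homog (- G) - r' = rho by eexists.
rewrite rhoE in wAct wr.
have rE : homog (- G) = r' + rho by rewrite -rhoE addrC subrK.
have [rho0|rho0] := eqVneq rho 0.
  rewrite rho0 addr0 in rE.
  (* The last coordinate of the homogenized identity normalizes the weights; the other coordinates
     give the slope. *)
  have w1 : \sum_(q <- Act) w q = 1.
    have := congr1 (fun v : 'rV_(n + 1) => v 0 (rshift n 0)) rE.
    rewrite -r'E /homog row_mxEr mxE summxE => ->; apply: eq_bigr => q _.
    by rewrite mxE row_mxEr mxE mulr1.
  pose u := \sum_(q <- Act) w q *: q.
  have [S SA Su] : exists2 S, (S `<=` Act)%fset & proper_comb S u.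
    by apply: conv_hull_proper_comb; exists w.
  exists S, u; split=> //.
  - by apply: fsubset_trans SA _; apply/fsubsetP => q; rewrite !inE => /andP[].
  - apply/rowP => i.
    have := congr1 (fun v : 'rV_(n + 1) => v 0 (lshift 1 i)) rE.
    rewrite -r'E /homog row_mxEl summxE => ->; rewrite mxE summxE.
    by apply: eq_bigr => q _; rewrite [RHS]mxE row_mxEl !mxE.
  - by move=> q /(fsubsetP SA); rewrite !inE => /andP[_ /eqP].
pose eta := dot rho rho.
have eta0 : 0 < eta by rewrite lt_neqAle dot_ge0 andbT eq_sym dot_eq0.
pose d := slope rho; pose tau := offset rho.
have homogE v : dot rho (homog v) = dot v d + tau.
  by rewrite dotC -[rho in LHS]hsubmxK dot_row_mx /dot big_ord1 mxE mul1r.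
have etaE : - dot G d + tau = eta.
  by rewrite -dotNl -homogE rE dotDr wr add0r.
have act q : q \in W -> affine q x = F -> dot (slope q) d + dot G d + eta <= 0.
  move=> qW qF; have := wAct q; rewrite homogE !inE qW qF eqxx => /(_ isT); lra.
pose a q := dot (slope q) d + dot G d + eta.
pose N := c * norm2 d ^+ 2.
(* With t = 1 / Z, the sum keeps inactive cuts below [F - t * dot G d - t * eta], and the last term
   keeps [t * N] below eta / 2. Active cuts contribute 0, by division by 0. *)
pose Z := 1 + \sum_(q <- W) `|a q| / (F - affine q x) + 2 * `|N| / eta.
have gap_ge0 q : q \in W -> 0 <= F - affine q x by move=> qW; rewrite subr_ge0 affine_le_max.
have Nge0 : 0 <= 2 * `|N| / eta by rewrite divr_ge0 ?(ltW eta0)// mulr_ge0.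
have term_ge0 q : q \in W -> 0 <= `|a q| / (F - affine q x).
  by move=> qW; rewrite divr_ge0// gap_ge0.
have sum_ge0 : 0 <= \sum_(q <- W) `|a q| / (F - affine q x).
  by rewrite big_seq; apply: sumr_ge0.
have Z0 : 0 < Z by rewrite /Z; lra.
pose t := Z^-1.
have t0 : 0 < t by rewrite invr_gt0.
have tZ : t * Z = 1 by rewrite mulVf ?gt_eqF.
have tN : t * N <= eta / 2.
  have : t * (2 * `|N| / eta) <= 1 by rewrite -[leRHS]tZ ler_pM2l// /Z lerDr addr_ge0.
  rewrite mulrA ler_pdivrMr// mul1r => h.
  by have := ler_wpM2l (ltW t0) (ler_norm N); lra.
have ta q : q \in W -> t * a q <= F - affine q x.
  move=> qW; have [qF|qF] := eqVneq (affine q x) F.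
    by rewrite qF subrr pmulr_rle0//; exact: act.
  have gap : 0 < F - affine q x by rewrite lt_neqAle gap_ge0// andbT eq_sym subr_eq0 eq_sym.
  have : t * (`|a q| / (F - affine q x)) <= 1.
    rewrite -[leRHS]tZ ler_pM2l//.
    apply: (@le_trans _ _ (\sum_(q <- W) `|a q| / (F - affine q x))); last first.
      by rewrite /Z -addrA addrCA lerDl addr_ge0.
    rewrite (big_fsetD1 q)//= lerDl big_seq; apply: sumr_ge0 => b.
    by rewrite !inE => /andP[_ /term_ge0].
  rewrite mulrA ler_pdivrMr// mul1r; apply: le_trans.
  by rewrite ler_pM2l// ler_norm.
pose y := x + t *: d.
have yx : y - x = t *: d by rewrite /y addrC addKr.
have fy : max_affine W y <= F - t * dot G d - t * eta.
  apply: max_affine_le => // q qW; rewrite (affine_shift q x y) yx dotZr.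
  by have := ta q qW; rewrite /a !mulrDr; lra.
have gy := gup y; rewrite yx dotZr norm2Z (gtr0_norm t0) exprMn in gy.
(* From [x] to [y] the objective drops by at least t eta / 2, against minimality. *)
have := xmin y; rewrite /= -/F.
have : t * (t * N) <= t * (eta / 2) by rewrite ler_pM2l.
have : 0 < t * eta by rewrite mulr_gt0.
rewrite /N in tN *; nra.
Qed.

End MaxAffine.

(** * The number of steps *)

(** The right side is the Pade approximant 2 (y - 1) / (y + 1). The function ln x + 4 / (x + 1) has
    derivative (x - 1)^2 / (x (x + 1)^2) >= 0 and value 2 at 1. *)
Lemma ln_le_pade (R : realType) (y : R) : 0 < y -> y <= 1 ->
  ln y <= 2 - 4 / (y + 1).
Proof.
move=> y0 y1.
pose f (x : R) := ln x + 4 * (x + 1)^-1.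
pose df (x : R) := x^-1 - 4 / (x + 1) ^+ 2.
have dfP (x : R) : 0 < x -> is_derive x (1 : R) f (df x).
  move=> x0; have x1 : x + 1 != 0 by rewrite gt_eqF// addr_gt0.
  have ln' := is_derive1_ln x0.
  rewrite /f /df; apply: is_derive_eq.
  by rewrite addr0 /GRing.scale/= mulr1 mulrN.
have [x||c] := @MVT_segment R f df y 1 y1.
- by rewrite in_itv/= => /andP[yx _]; apply: dfP; exact: lt_trans yx.
- apply: derivable_within_continuous => x; rewrite in_itv/= => /andP[yx _].
  by case: (dfP x (lt_le_trans y0 yx)).
rewrite in_itv/= => /andP[yc _] e.
have c0 : 0 < c by exact: lt_le_trans yc.
have : 0 <= df c * (1 - y).
  apply: mulr_ge0; last by rewrite subr_ge0.
  have -> : df c = (c - 1) ^+ 2 / (c * (c + 1) ^+ 2).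
    by rewrite /df; field; rewrite !gt_eqF// ltr_wpDr.
  by rewrite divr_ge0 ?sqr_ge0// mulr_ge0 ?sqr_ge0 ?ltW.
rewrite -e subr_ge0 /f ln1 add0r => h.
have -> : 2 - 4 / (y + 1) = 4 / (1 + 1) - 4 / (y + 1) :> R by field; rewrite gt_eqF// addr_gt0.
lra.
Qed.

Lemma le_ln_tangent (R : realType) (x : R) : 0 < x -> 1 - x <= ln x^-1.
Proof.
move=> x0; rewrite lnV ?posrE//.
have := @le_ln1Dx R (x - 1) ltac:(lra).
by rewrite addrCA subrr addr0; lra.
Qed.

Lemma ln2_bounds (R : realType) : (69 / 100 <= ln (2 : R)) /\ ln (2 : R) <= 71 / 100.
Proof.
split.
- have h (k m c : R) : 0 < k -> m = k + 1 -> c = 2 * k + 1 ->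
      2 / c <= - ln (k / m).
    move=> k0 -> ->; have k1 : 0 < k + 1 by lra.
    have := @ln_le_pade R (k / (k + 1)) (divr_gt0 k0 k1).
    rewrite ler_pdivrMr// mul1r lerDl => /(_ ler01).
    have -> : 2 - 4 / (k / (k + 1) + 1) = - (2 / (2 * k + 1)) :> R.
      by field; rewrite !gt_eqF//; lra.
    by rewrite lerNr.
  (* The quotients telescope to 1/2 and each is close enough to 1 for the Pade bound. *)
  have -> : ln (2 : R) = - ln (4/5 : R) - ln (5/6 : R) - ln (6/7 : R) - ln (7/8 : R).
    have -> : ln (4/5 : R) = ln 4 - ln 5 by rewrite ln_div ?posrE//; lra.
    have -> : ln (5/6 : R) = ln 5 - ln 6 by rewrite ln_div ?posrE//; lra.
    have -> : ln (6/7 : R) = ln 6 - ln 7 by rewrite ln_div ?posrE//; lra.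
    have -> : ln (7/8 : R) = ln 7 - ln 8 by rewrite ln_div ?posrE//; lra.
    have -> : ln (8 : R) = ln 2 + ln 4 by rewrite -lnM ?posrE//; congr ln; lra.
    lra.
  have := @h 4 5 9 ltac:(lra) ltac:(lra) ltac:(lra).
  have := @h 5 6 11 ltac:(lra) ltac:(lra) ltac:(lra).
  have := @h 6 7 13 ltac:(lra) ltac:(lra) ltac:(lra).
  have := @h 7 8 15 ltac:(lra) ltac:(lra) ltac:(lra).
  lra.
- have sq (a b x : R) : 0 <= a -> a <= x -> b <= a * a -> b <= x ^+ 2.
    by move=> a0 ax ba; rewrite expr2; apply: (le_trans ba); exact: ler_pM.
  (* Repeated squaring with rounding down gives y^32 >= 2, and 32 times 71/3200 is 71/100. *)
  pose y : R := 71/3200 + 1.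
  have [y1 y0] : 1 + (y - 1) = y /\ y - 1 = 71/3200 by rewrite /y; split; lra.
  have h : 2 <= y ^+ 32.
    have -> : y ^+ 32 = ((((y ^+ 2) ^+ 2) ^+ 2) ^+ 2) ^+ 2 by rewrite -!exprM.
    apply: (@sq (1419/1000)); [lra| |lra].
    apply: (@sq (2383/2000)); [lra| |lra].
    apply: (@sq (2729/2500)); [lra| |lra].
    by apply: (@sq (1306/1250)); [lra| |lra]; rewrite expr2 /y; lra.
  clearbody y; have yp : 0 < y by lra.
  have := @le_ln1Dx R (y - 1) ltac:(lra).
  have : ln (2 : R) <= ln (y ^+ 32) by rewrite ler_ln// posrE// exprn_gt0.
  by rewrite lnXn// y1 y0 -mulr_natl; lra.
Qed.

(** This is [rate_ineq] at r = e. The logarithm is bounded below by its tangents at 1/2, 1/8 and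
    1/32, each on its own range of [e]. *)
Lemma rate_endpoint_small (R : realType) (e : R) : 0 < e -> e <= 39/64 ->
  2 * ln 2 - (1 / 2 + ln 2) * e + 3 / 4 * e ^+ 2 <= (2 / 5 + 13 / 5 * e) * ln e^-1.
Proof.
move=> e0 e1; have [l1 l2] := ln2_bounds R; set l := ln 2 in l1 l2 *.
have tangent (i : nat) : i%:R * l + 1 - 2 ^+ i * e <= ln e^-1.
  have p2 : 0 < 2 ^+ i :> R by rewrite exprn_gt0.
  have := @le_ln_tangent R (2 ^+ i * e) (mulr_gt0 p2 e0).
  rewrite !lnV ?posrE ?mulr_gt0// lnM ?posrE// lnXn// -/l -[l *+ i]mulr_natl; lra.
have c0 : 0 <= 2 / 5 + 13 / 5 * e by lra.
have [h|h] := leP e (22/100); last first.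
  have t := tangent 1%N; rewrite expr1 mul1r in t.
  apply: le_trans (ler_wpM2l c0 t); nra.
have [h'|h'] := leP e (5/100); last first.
  have t := tangent 3%N; rewrite (_ : 2 ^+ 3 = 8) in t; last by ring.
  apply: le_trans (ler_wpM2l c0 t); nra.
have t := tangent 5%N; rewrite (_ : 2 ^+ 5 = 32) in t; last by ring.
apply: le_trans (ler_wpM2l c0 t); nra.
Qed.

(** The difference of the two sides is affine in [r], so the endpoints r = e and r = 1 suffice. *)
Lemma rate_ineq (R : realType) (e r : R) :
  0 < e -> e <= 39/64 -> e <= r -> r <= 1 ->
  r + (1 - r / 2) * (2 * ln e^-1 + 2 * ln 2 - 3 / 2 * e)
    <= (12 / 5 + 8 / 5 * r) * ln e^-1.
Proof.
move=> e0 e1 er r1; have small := rate_endpoint_small e0 e1.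
have [l1 l2] := ln2_bounds R.
have large : 1 + ln 2 - 3 / 4 * e <= 3 * ln e^-1.
  have := @le_ln_tangent R (2 * e) ltac:(lra).
  rewrite !lnV ?posrE ?mulr_gt0// lnM ?posrE//; lra.
set l := ln e^-1 in small large *; set l2' := ln 2 in small large l1 l2 *.
pose g x := x + (1 - x / 2) * (2 * l + 2 * l2' - 3 / 2 * e)
             - (12 / 5 + 8 / 5 * x) * l.
have ge : g e <= 0 by rewrite /g; lra.
have g1 : g 1 <= 0 by rewrite /g; lra.
have gr : (1 - e) * g r = (1 - r) * g e + (r - e) * g 1 by rewrite /g; ring.
have : (1 - e) * g r <= 0.
  rewrite gr; have := @mulr_ge0_le0 R (1 - r) (g e); have := @mulr_ge0_le0 R (r - e) (g 1).
  lra.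
rewrite pmulr_rle0; last by lra.
by rewrite /g; lra.
Qed.

Lemma geometric_le (R : realType) (n : nat) (d : nat -> R) (r : R) : r <= 1 ->
  (forall i, (i < n)%N -> d i.+1 <= d i - r * d i) -> d n <= (1 - r) ^+ n * d 0%N.
Proof.
move=> r1; elim: n => [|n IH] h; first by rewrite expr0 mul1r.
apply: le_trans (h n (leqnn _)) _.
have /IH dn : forall i, (i < n)%N -> d i.+1 <= d i - r * d i by move=> i ?; apply: h; exact: ltnW.
have -> : d n - r * d n = (1 - r) * d n by ring.
by rewrite exprS -mulrA ler_wpM2l// subr_ge0.
Qed.

(* [d] is the gap and [e] the accuracy, in units of D^2 / (2 mu). The last
   decrease only forces [d] to be at least about [e^2 / 4] before it, a range of
   length [2 * ln e^-1] on the logarithmic scale; the factor 12/5 > 2 and the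
   second decrease together keep the bound a multiple of [ln e^-1]. *)
Lemma nat_le_log_rate (R : realType) (n : nat) (d : nat -> R) (e r : R) :
  0 < e -> 0 < r -> d 0%N <= 1 - e ->
  (forall i, (i <= n)%N -> 0 <= d i) ->
  (forall i, (i < n)%N -> d i.+1 <= d i - r * d i) ->
  (forall i, (i < n)%N -> d i.+1 <= d i - (e + d i) ^+ 2 / 4) ->
  n%:R <= (12 / 5 / r + 8 / 5) * ln e^-1.
Proof.
move=> e0 r0 d0 dge dr dq.
have d00 : 0 <= d 0%N by apply: dge.
have e1 : e <= 1 by lra.
have le0 : 0 <= ln e^-1 by apply: ln_ge0; rewrite invf_ge1.
have C0 : 0 < 12 / 5 / r + 8 / 5.
  by have := invr_gt0 r; rewrite r0; lra.
case: n dge dr dq => [|n] dge dr dq; first by apply: mulr_ge0 => //; exact: ltW.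
have dp i : (i <= n)%N -> 0 < d i /\ (e + d i) ^+ 2 <= 4 * d i.
  move=> ni; have := dq i ni; have := dge i.+1 ni => h1 h2.
  have : (e + d i) ^+ 2 <= 4 * d i by lra.
  split=> //; have := dge i (leqW ni) => h3.
  have : 0 < (e + d i) ^+ 2 by rewrite exprn_gt0// ltr_pwDl.
  lra.
have r1 : r <= 1.
  have [d0p _] := dp 0%N isT; have := dr 0%N isT; have := dge 1%N isT.
  move=> h1 h2; rewrite -(ler_pM2r d0p); lra.
(* For y = e + d i one has e <= y - y^2 / 4, and the next y is at most y - y^2 / 4. Starting from y
   <= 1 this gives 3/4 here and 39/64 once there is a second step. *)
have e34 : e <= 3 / 4 by have [_] := dp 0%N isT; nra.
(* Since (e + d)^2 >= 4 e d, the quadratic decrease also yields the linear rate [e]. The bound for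
   the larger rate [s] implies that for [r]. *)
pose s := Num.max r e.
have s0 : 0 < s by rewrite lt_max r0.
have s1 : s <= 1 by rewrite ge_max r1/=; lra.
have es : e <= s by rewrite le_max lexx orbT.
have rs : r <= s by rewrite le_max lexx.
have ds i : (i < n.+1)%N -> d i.+1 <= d i - s * d i.
  move=> ni; rewrite /s; case: (leP r e) => _; last exact: dr.
  by apply: le_trans (dq i ni) _; have := sqr_ge0 (e - d i); lra.
suff : s * n.+1%:R <= (12 / 5 + 8 / 5 * s) * ln e^-1.
  rewrite mulrC -ler_pdivlMr// => /le_trans; apply.
  rewrite mulrAC ler_wpM2r// mulrDl mulfK ?gt_eqF// lerD2r.
  by rewrite ler_pM2l ?lef_pV2// ?posrE//; lra.
case: n dp ds {dge dr} dq => [|n] dp ds dq.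
  rewrite mulr1; have := @le_ln_tangent R e e0.
  move=> h; have := @ler_wpM2l R (12 / 5 + 8 / 5 * s) ltac:(lra) _ _ h; nra.
have e2 : e <= 39 / 64.
  have [_ h0] := dp 0%N isT; have [_ h1] := dp 1%N isT.
  have h01 := dq 0%N isT.
  have y1 : e + d 1%N <= 3 / 4 by nra.
  nra.
have [dn0 dn] := dp n.+1 (leqnn _).
have := geometric_le s1 (fun i h => ds i (leqW h)).
have s1' : s < 1.
  have := ds 0%N isT; have [d1 _] := dp 1%N isT; have [d0p _] := dp 0%N isT => h.
  have : 0 < (1 - s) * d 0%N by lra.
  by rewrite pmulr_lgt0// subr_gt0.
have p1 : 0 < 1 - s by rewrite subr_gt0.
(* With z the square root of [d n.+1], the last decrease gives e + z^2 <= 2 z, so z >= e / 2 and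
   then e <= z (2 - e / 2). *)
have dlow : (e / (2 - e / 2)) ^+ 2 <= d n.+1.
  have sd0 := sqrtr_ge0 (d n.+1); have sd := sqr_sqrtr (ltW dn0).
  rewrite -sd lerXn2r ?nnegrE ?divr_ge0//; [lra|lra|].
  rewrite ler_pdivrMr; last lra.
  set z := Num.sqrt _ in sd0 sd *.
  have ez : e + z ^+ 2 <= 2 * z.
    rewrite -(@ler_sqr R (e + z ^+ 2) (2 * z)) ?nnegrE; [|nra|lra].
    by rewrite sd exprMn sd; lra.
  nra.
move=> up.
have a0 : 0 < e / (2 - e / 2) by apply: divr_gt0; lra.
have a1 : 0 < (1 - s) ^+ n.+1 by exact: exprn_gt0.
have a2 : 0 < 1 - e by lra.
(* Logarithms of the lower bound and of the geometric upper bound at index [n.+1] limit [n.+1]; the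
   last of the [n.+2] steps is the summand [r] of [rate_ineq]. *)
have : ln ((e / (2 - e / 2)) ^+ 2) <= ln ((1 - s) ^+ n.+1 * (1 - e)).
  rewrite ler_ln ?posrE ?exprn_gt0 ?(mulr_gt0 a1 a2)//.
  by apply: le_trans dlow (le_trans up _); rewrite ler_pM2l.
have -> : ln ((1 - s) ^+ n.+1 * (1 - e)) = n.+1%:R * ln (1 - s) + ln (1 + - e).
  by rewrite lnM ?posrE// lnXn// mulr_natl.
have -> : ln ((e / (2 - e / 2)) ^+ 2) = 2 * (ln e - (ln 2 + ln (1 + - (e / 4)))).
  rewrite -lnM ?posrE//; last by lra.
  rewrite (_ : 2 * (1 + - (e / 4)) = 2 - e / 2); last by field.
  by rewrite lnXn// ln_div ?posrE//; [ring|lra].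
have := @le_ln1Dx R (- (e / 4)) ltac:(lra).
have := @le_ln1Dx R (- e) ltac:(lra).
have := rate_ineq e0 e2 es s1.
have := ln_le_pade p1 ltac:(lra).
have -> : 2 - 4 / (1 - s + 1) = - (s / (1 - s / 2)) by field; rewrite !gt_eqF//; lra.
rewrite lnV ?posrE//.
set u := ln (1 - s); set w := ln (1 + - e); set z := ln (1 + - (e / 4)).
set l2 := ln 2; set le := ln e.
move=> h1 h2 h3 h4 h5.
have s2 : 0 < 1 - s / 2 by lra.
have n0 : 0 <= n.+1%:R :> R by [].
have : n.+1%:R * (s / (1 - s / 2)) <= - 2 * le + 2 * l2 - 3 / 2 * e.
  have := ler_wpM2l n0 h1; lra.
rewrite mulrA ler_pdivrMr// -natr1.
lra.
Qed.

(** * Kelley's method *)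

(* The weight 2/3 in Young's inequality for [b ^+ 2] is the one for which the
   term in [L * X ^+ 2] and the term in [M * X] lose the same factor 5/12
   against [2 * L * X ^+ 2 + 6 * M * X]. *)
Lemma gap_error_ineq (R : realType) (L M X Y a b Delta delta gam e G : R) :
  0 <= L -> 0 <= Y <= X -> 0 <= a -> 0 <= b -> 0 < delta <= Delta ->
  delta <= M * X -> a ^+ 2 <= 2 * L * (Delta - delta) -> b <= Delta + Y * a ->
  e ^+ 2 = a ^+ 2 + b ^+ 2 -> 0 <= gam -> gam * Delta <= G * e ->
  gam ^+ 2 * delta <=
    G ^+ 2 * (L / 2 + 5 / 12 * (2 * L * X ^+ 2 + 6 * M * X)).
Proof.
move=> L0 /andP[Y0 YX] a0 b0 /andP[d0 dD] dMX aL bY eE gam0 ge.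
set B := L / 2 + _.
have D0 : 0 < Delta by exact: lt_le_trans dD.
have YX2 : Y ^+ 2 <= X ^+ 2 by rewrite ler_sqr ?nnegrE//; exact: le_trans YX.
have b2 : b ^+ 2 <= 5 / 2 * Delta ^+ 2 + 5 / 3 * (Y ^+ 2 * a ^+ 2).
  apply: (@le_trans _ _ ((Delta + Y * a) ^+ 2)).
    by rewrite ler_sqr ?nnegrE// addr_ge0 ?mulr_ge0// ltW.
  by have := sqr_ge0 (3 * Delta - 2 * (Y * a)); lra.
(* This is 4 delta (Delta - delta) <= Delta^2. *)
have da : delta * a ^+ 2 <= L / 2 * Delta ^+ 2.
  apply: (@le_trans _ _ (delta * (2 * L * (Delta - delta)))).
    by rewrite ler_wpM2l// ltW.
  by have := mulr_ge0 L0 (sqr_ge0 (Delta - 2 * delta)); lra.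
have eB : delta * e ^+ 2 <= B * Delta ^+ 2.
  have Y2 : Y ^+ 2 * (delta * a ^+ 2) <= X ^+ 2 * (L / 2 * Delta ^+ 2).
    by apply: ler_pM => //; [exact: sqr_ge0|rewrite mulr_ge0 ?sqr_ge0// ltW].
  have dMX2 : delta * Delta ^+ 2 <= M * X * Delta ^+ 2 by rewrite ler_wpM2r ?sqr_ge0.
  have := ler_wpM2l (ltW d0) b2; rewrite eE /B; lra.
have h : (gam * Delta) ^+ 2 <= (G * e) ^+ 2.
  have gD : 0 <= gam * Delta by rewrite mulr_ge0// ltW.
  by rewrite ler_sqr ?nnegrE// (le_trans gD).
have D2 : 0 < Delta ^+ 2 by rewrite exprn_gt0.
rewrite -(ler_pM2r D2).
apply: (@le_trans _ _ (G ^+ 2 * (delta * e ^+ 2))).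
  by have := ler_wpM2l (ltW d0) h; rewrite !exprMn; lra.
by rewrite -[leRHS]mulrA ler_wpM2l ?sqr_ge0.
Qed.

Section KelleyStep.
Variables (R : realType) (n : nat) (g : 'rV[R]_n -> R) (mu L : R).
Variables (V : {fset 'rV[R]_(n + 1)}) (xs : 'rV[R]_n).
Hypotheses (n0 : (0 < n)%N) (mu0 : 0 < mu).
Hypotheses (g_cvx : strongly_convex mu g) (g_smooth : smooth L g).
Hypotheses (V0 : V != fset0%fset).
Hypothesis xs_min : minimizer (fun y => g y + max_affine V y) xs.
Implicit Types (W S : {fset 'rV[R]_(n + 1)}) (x y : 'rV[R]_n) (u v : 'rV[R]_(n + 1)).
Local Notation G := (gradient g).
Local Notation h := (fun y => g y + max_affine V y).
Local Notation M := (lipschitz_const (max_affine V)).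
Local Notation X := (2 * M / mu + norm2 xs).

Lemma minimizer_subgradient W x : W != fset0%fset ->
  minimizer (fun y => g y + max_affine W y) x ->
  exists S u, [/\ (S `<=` W)%fset, proper_comb S u, slope u = - G x
    & forall q, q \in S -> affine q x = max_affine W x].
Proof.
move=> W0; apply: (@minimizer_slope _ _ _ (L / 2)) => // y.
exact: (descent_le mu0 g_cvx g_smooth).
Qed.

Lemma norm2_slope_conv_hull u : conv_hull V u -> norm2 (slope u) <= M.
Proof.
move=> [w [w0 w1 ->]].
have -> : slope (\sum_(p <- V) w p *: p) = \sum_(p <- V) w p *: slope p.
  apply/rowP => i; rewrite mxE !summxE; apply: eq_bigr => p _.
  by rewrite !mxE.
apply: le_trans (ler_norm2_sum _ _ _) _.
rewrite -[leRHS]mul1r -w1 mulr_suml big_seq [leRHS]big_seq.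
apply: ler_sum => p pV; rewrite norm2Z ger0_norm ?w0//.
by rewrite ler_wpM2l ?w0//; exact: norm2_slope_le_lipschitz.
Qed.

Lemma lipschitz_const_ge0 : 0 <= M.
Proof.
have /fset0Pn[p pV] := V0.
exact: le_trans (norm2_ge0 _) (norm2_slope_le_lipschitz pV).
Qed.

Lemma model_gap_ge0 W x : W != fset0%fset -> (W `<=` V)%fset ->
  minimizer (fun y => g y + max_affine W y) x ->
  0 <= h xs - (g x + max_affine W x).
Proof.
by move=> W0 WV /(_ xs); have := max_affine_sub xs W0 WV; rewrite /=; lra.
Qed.

(** At both minimizers the gradient is minus the slope of a point of the hull, so the gradients
    differ by at most 2 M, and strong monotonicity concludes. *)
Lemma minimizer_dist W x : W != fset0%fset -> (W `<=` V)%fset ->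
  minimizer (fun y => g y + max_affine W y) x -> norm2 (x - xs) <= 2 * M / mu.
Proof.
move=> W0 WV xmin.
have [S [u [SW Su uE _]]] := minimizer_subgradient W0 xmin.
have [S' [u' [S'V S'u' u'E _]]] := minimizer_subgradient V0 xs_min.
have uM := norm2_slope_conv_hull (proper_comb_conv_hull (fsubset_trans SW WV) Su).
have u'M := norm2_slope_conv_hull (proper_comb_conv_hull S'V S'u').
have := gradient_monotone g_cvx x xs.
have := dot_le_norm2 (G x - G xs) (x - xs).
have := ler_norm2B (G x) (G xs).
rewrite uE norm2N in uM; rewrite u'E norm2N in u'M.
set N := norm2 (x - xs); set K := norm2 (G x - G xs) => h1 h2 h3.
have N0 : 0 <= N := norm2_ge0 _.
have [->|Nn0] := eqVneq N 0.
  by rewrite divr_ge0 ?(ltW mu0)// mulr_ge0// lipschitz_const_ge0.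
have {}N0 : 0 < N by rewrite lt_neqAle eq_sym Nn0.
rewrite ler_pdivlMr// -(ler_pM2r N0).
have : K * N <= 2 * M * N by rewrite ler_pM2r//; lra.
lra.
Qed.

Lemma minimizer_norm2 W x : W != fset0%fset -> (W `<=` V)%fset ->
  minimizer (fun y => g y + max_affine W y) x -> norm2 x <= X.
Proof.
move=> W0 WV xmin; have := minimizer_dist W0 WV xmin.
by have := ler_norm2D (x - xs) xs; rewrite subrK; lra.
Qed.

(** With u' the active combination at [xs] and u that at [x], [PWidth_dot_le] in direction [homog x]
    bounds their height difference Delta at [x]. Delta minus the gap is a Bregman divergence of g,
    which controls the slope part of u' - u by cocoercivity. *)
Lemma model_gap_le W x : W != fset0%fset -> (W `<=` V)%fset ->
  minimizer (fun y => g y + max_affine W y) x ->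
  h xs - (g x + max_affine W x) <= M * X ->
  PWidth V ^+ 2 * (h xs - (g x + max_affine W x)) <=
    (max_affine V x - max_affine W x) ^+ 2
      * (L / 2 + 5 / 12 * (2 * L * X ^+ 2 + 6 * M * X)).
Proof.
move=> W0 WV xmin; set delta := h xs - _ => dMX.
have L0 : 0 <= L := le_trans (ltW mu0) (modulus_le_lipschitz g_cvx g_smooth n0).
have M0 := lipschitz_const_ge0.
have X0 : 0 <= X by rewrite addr_ge0 ?norm2_ge0// divr_ge0 ?(ltW mu0)// mulr_ge0.
have [d0|dn0] := leP delta 0.
  apply: (@le_trans _ _ 0); first by rewrite mulr_ge0_le0 ?sqr_ge0.
  have LX := mulr_ge0 L0 (sqr_ge0 X); have MX := mulr_ge0 M0 X0.
  by apply: mulr_ge0; [exact: sqr_ge0|lra].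
have [S [u [SW Su uE uact]]] := minimizer_subgradient W0 xmin.
have [S' [u' [S'V S'u' u'E u'act]]] := minimizer_subgradient V0 xs_min.
have SV := fsubset_trans SW WV.
have u'V := proper_comb_conv_hull S'V S'u'.
have ux := proper_comb_affine_eq Su uact.
have u'xs := proper_comb_affine_eq S'u' u'act.
pose Delta := dot (homog x) (u' - u).
pose a := norm2 (slope u' - slope u).
have DeltaE : Delta = affine u' x - affine u x.
  by rewrite /Delta dotBr !(dotC (homog x)) -!affine_dot.
have bregman : Delta - delta = g x - g xs - dot (G xs) (x - xs).
  rewrite DeltaE ux /delta (affine_shift u' xs x) u'xs u'E dotNl; lra.
have aE : a = norm2 (G x - G xs) by rewrite /a uE u'E opprK addrC.
have aL : a ^+ 2 <= 2 * L * (Delta - delta).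
  by rewrite aE bregman; exact: (sqr_gradient_le_bregman mu0 g_cvx g_smooth).
have dD : delta <= Delta.
  by rewrite -subr_ge0 bregman; have := subgradient_le mu0 g_cvx xs x; lra.
apply: (@gap_error_ineq _ _ _ _ (norm2 x) a `|offset (u' - u)| Delta delta
  (PWidth V) (norm2 (u' - u))) => //.
- by rewrite norm2_ge0 (minimizer_norm2 W0 WV xmin).
- exact: norm2_ge0.
- by rewrite dn0.
(* The offset part is what Delta leaves after the slopes are evaluated at [x]. *)
- have offE : offset (u' - u) = Delta - dot (slope u' - slope u) x.
    rewrite DeltaE /affine -slopeB /slope /offset !mxE !raddfB/= !dotBl; ring.
  rewrite offE; apply: le_trans (ler_normB _ _) _.
  rewrite ger0_norm ?(le_trans (ltW dn0))// lerD2l.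
  by apply: le_trans (ler_norm_dot _ _) _; rewrite mulrC.
- by rewrite sqr_norm2 dot_slope_offset slopeB -sqr_norm2 real_normK ?num_real// -expr2.
- exact: PWidth_ge0.
- apply: (PWidth_dot_le SV Su u'V) => [|p s pV sS]; first exact: lt_le_trans dD.
  rewrite dotBr !(dotC (homog x)) -!affine_dot (uact s sS).
  by rewrite lerD2r affine_le_max.
Qed.

(** The point (1 - t) u + t p minorizes the new model. As [slope u] cancels the gradient at [x],
    only the linear term with slope t (slope p - slope u) remains, and strong convexity absorbs it
    by completing a square. *)
Lemma model_step W x (p : 'rV[R]_(n + 1)) y (t : R) :
  W != fset0%fset -> (W `<=` V)%fset ->
  minimizer (fun z => g z + max_affine W z) x -> p \in V ->
  (forall q, q \in V -> affine q x <= affine p x) -> 0 <= t <= 1 ->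
  exists2 u, conv_hull V u &
  h xs - (g y + max_affine (W `|` [fset p])%fset y) <=
    h xs - (g x + max_affine W x) - t * (max_affine V x - max_affine W x)
      + t ^+ 2 * (norm2 (slope p - slope u) ^+ 2 / (2 * mu)).
Proof.
move=> W0 WV xmin pV pmax /andP[t0 t1].
have [S [u [SW Su uE uact]]] := minimizer_subgradient W0 xmin.
exists u; first exact: proper_comb_conv_hull (fsubset_trans SW WV) Su.
have ux := proper_comb_affine_eq Su uact.
have uW := proper_comb_conv_hull SW Su.
set W' := (W `|` [fset p])%fset.
have WW' : (W `<=` W')%fset by exact: fsubsetUl.
have fp : max_affine V x <= affine p x by exact: max_affine_le.
have f1 : affine p y <= max_affine W' y.
  by apply: affine_le_max; rewrite !inE eqxx orbT.
have f2 := le_trans (conv_hull_affine_le y uW) (max_affine_sub y W0 WW').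
rewrite (affine_shift p x y) in f1; rewrite (affine_shift u x y) ux uE dotNl in f2.
have := g_cvx x y; rewrite norm2B.
have := ler_norm_dot (slope p - slope u) (y - x).
rewrite ler_norml dotBl => /andP[+ _]; rewrite {2}uE dotNl.
set K := norm2 (slope p - slope u); set N := norm2 (y - x).
set A := dot (slope p) _ in f1 *; set B := dot (G x) _ in f2 *.
set F := max_affine W' y in f1 f2 *.
move=> h1 h2.
have h3 : (1 - t) * (max_affine W x - B) + t * (max_affine V x + A) <= F.
  have := ler_wpM2l t0 f1; have := @ler_wpM2l _ (1 - t) _ _ _ f2.
  rewrite subr_ge0 t1 => /(_ isT); have := ler_wpM2l t0 fp; lra.
have h4 : t ^+ 2 * (K ^+ 2 / (2 * mu)) = (t * K) ^+ 2 / (2 * mu) by rewrite exprMn mulrA.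
have h5 : - (t * K * N) <= t * (A + B) by have := ler_wpM2l t0 h1; lra.
have h6 : t * K * N <= (t * K) ^+ 2 / (2 * mu) + mu / 2 * N ^+ 2.
  have -> : (t * K) ^+ 2 / (2 * mu) + mu / 2 * N ^+ 2 =
      t * K * N + (t * K - mu * N) ^+ 2 / (2 * mu) by field; rewrite gt_eqF.
  by rewrite lerDl divr_ge0 ?sqr_ge0// mulr_ge0// ltW.
rewrite h4 /=; lra.
Qed.

End KelleyStep.

Lemma diameter_conv_hull_gt0 (R : realType) (m : nat) (V : {fset 'rV[R]_m}) :
  0 < diameter (conv_hull V) ->
  exists a b, [/\ a \in V, b \in V & a != b].
Proof.
move=> D0; apply: contrapT => h.
have eqV a b : a \in V -> b \in V -> a = b.
  by move=> aV bV; apply/eqP; apply: contrapT => /negP ab; apply: h; exists a, b.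
suff : diameter (conv_hull V) <= 0 by rewrite leNgt D0.
have eqC u v : conv_hull V u -> conv_hull V v -> u = v.
  move=> uV; have [a aV] := conv_hull_neq0 uV; move: uV v.
  suff eqa w : conv_hull V w -> w = a by move=> /eqa-> v /eqa->.
  move=> [c [_ c1 ->]]; rewrite -[RHS]scale1r -c1 scaler_suml.
  by rewrite big_seq [RHS]big_seq; apply: eq_bigr => b bV; rewrite (eqV b a).
rewrite /diameter; set E := [set _ | _ in _ & _ in _].
have [->|/set0P E0] := eqVneq E set0; first by rewrite sup0.
apply: ge_sup => // _ [p pV [q qV <-]].
by rewrite (eqC p q)// subrr norm2_0.
Qed.

Lemma diameter_ge0 (R : realType) (m : nat) (A : set 'rV[R]_m) : 0 <= diameter A.
Proof.
rewrite /diameter; set E := [set _ | _ in _ & _ in _].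
have [hE|/sup_out->//] := pselect (has_sup E).
have [_ [p Ap [q Aq _]]] := hE.1.
apply: le_trans (norm2_ge0 (p - q)) _; apply: ub_le_sup; first exact: hE.2.
by exists p => //; exists q.
Qed.

Section KelleyRun.
Variables (R : realType) (n : nat) (g : 'rV[R]_n -> R) (mu L : R).
Variables (V : {fset 'rV[R]_(n + 1)}) (xs : 'rV[R]_n) (eps : R).
Variables (Vs : nat -> {fset 'rV[R]_(n + 1)}) (x : nat -> 'rV[R]_n).
Variable (p : nat -> 'rV[R]_(n + 1)).
Hypotheses (n0 : (0 < n)%N) (mu0 : 0 < mu).
Hypotheses (g_cvx : strongly_convex mu g) (g_smooth : smooth L g).
Hypotheses (V0 : V != fset0%fset).
Hypothesis xs_min : minimizer (fun y => g y + max_affine V y) xs.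
Hypotheses (eps0 : 0 < eps) (run : kelley_run g V eps Vs x p).
Local Notation h := (fun y => g y + max_affine V y).
Local Notation M := (lipschitz_const (max_affine V)).
Local Notation X := (2 * M / mu + norm2 xs).
Local Notation D := (diameter (conv_hull V)).
Local Notation Db := (diameter (rsubmx @` conv_hull V)).
Local Notation gam := (PWidth V).

Let Q := D ^+ 2 / (2 * mu).
Let gap k := h xs - (g (x k.+1) + max_affine (Vs k) (x k.+1)).
Let G k := max_affine V (x k.+1) - max_affine (Vs k) (x k.+1).
Let bad k := eps < h (x k.+1) - h xs.

Lemma run_models k : (forall j, (j < k)%N -> continues V eps Vs x j) ->
  Vs k != fset0%fset /\ (Vs k `<=` V)%fset.
Proof.
have [Vs0 Vs0V step] := run; elim: k => [//|k IH] cont.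
have contk j : (j < k)%N -> continues V eps Vs x j by move=> jk; apply: cont; exact: ltnW.
have [/fset0Pn[q qVs] VsV] := IH contk; have [_ pV _ ->] := step k contk.
split; first by apply/fset0Pn; exists q; rewrite inE qVs.
by rewrite fsubUset VsV fsub1set.
Qed.

Lemma run_iteration k : (forall j, (j < k)%N -> continues V eps Vs x j) ->
  [/\ minimizer (fun y => g y + max_affine (Vs k) y) (x k.+1), p k.+1 \in V,
      forall q, q \in V -> affine q (x k.+1) <= affine (p k.+1) (x k.+1)
    & Vs k.+1 = (Vs k `|` [fset p k.+1])%fset].
Proof. by case: run => _ _; exact. Qed.

(** The excess of [h] is [G k - gap k] with [gap k] nonnegative, so a bad iterate fails the stopping
    test. The induction is there because the run is constrained only while tests fail. *)
Lemma bad_continues k : (forall j, (j < k)%N -> bad j) ->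
  forall j, (j < k)%N -> continues V eps Vs x j.
Proof.
elim: k => [//|k IH] badk j; have {}IH := IH (fun j jk => badk j (ltnW jk)).
rewrite ltnS leq_eqVlt => /predU1P[->|]; last exact: IH.
have [Vk VkV] := run_models IH; have [xmin _ _ _] := run_iteration IH.
have := model_gap_ge0 xs Vk VkV xmin; have := badk k (ltnSn k).
rewrite /bad /continues /=; lra.
Qed.

(** The slope distance in [model_step] is at most D and at most 2 M; the first bound drives the
    rate, the second leads to gap <= M X. *)
Lemma gap_step k (t : R) : (forall j, (j < k.+1)%N -> bad j) -> 0 <= t <= 1 ->
  [/\ gap k.+1 <= gap k - t * G k + t ^+ 2 * Q,
      gap k.+1 <= gap k - t * G k + t ^+ 2 * (2 * M ^+ 2 / mu) & 0 <= gap k.+1].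
Proof.
move=> badk t01; have cont := bad_continues badk.
have contk j : (j < k)%N -> continues V eps Vs x j by move=> jk; apply: cont; exact: ltnW.
have [Vk VkV] := run_models contk; have [VSk VSkV] := run_models cont.
have [xmin pV pmax VsE] := run_iteration contk; have [xSmin _ _ _] := run_iteration cont.
have [u uV] := model_step xs mu0 g_cvx g_smooth V0 (x k.+2) Vk VkV xmin pV pmax t01.
rewrite -VsE -/(gap k.+1) -/(gap k) -/(G k) => le_gap.
have slope2 : norm2 (slope (p k.+1) - slope u) <= D.
  rewrite -slopeB; apply: le_trans (norm2_slope_le _) _.
  exact: le_diameter (@norm2_conv_hull_le _ _ V) (mem_conv_hull pV) uV.
have slopeM : norm2 (slope (p k.+1) - slope u) <= 2 * M.
  apply: le_trans (ler_norm2B _ _) _.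
  have := norm2_slope_conv_hull (mem_conv_hull pV); have := norm2_slope_conv_hull uV; lra.
have bound c : norm2 (slope (p k.+1) - slope u) <= c ->
    gap k.+1 <= gap k - t * G k + t ^+ 2 * (c ^+ 2 / (2 * mu)).
  move=> Kc; apply: le_trans le_gap _; rewrite lerD2l ler_wpM2l ?sqr_ge0//.
  rewrite ler_pM2r ?invr_gt0 ?mulr_gt0// ler_sqr ?nnegrE ?norm2_ge0//.
  exact: le_trans (norm2_ge0 _) Kc.
split; [exact: bound| |exact: (model_gap_ge0 xs VSk VSkV xSmin)].
have -> : 2 * M ^+ 2 / mu = (2 * M) ^+ 2 / (2 * mu) by field; rewrite gt_eqF.
exact: bound.
Qed.

(** With t = 1 the initial gap drops out, since badness means G 0 - gap 0 > eps; with t = 0 the gaps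
    do not increase afterwards. *)
Lemma gap_later k : (forall j, (j < k.+1)%N -> bad j) ->
  [/\ gap k.+1 <= Q - eps, gap k.+1 <= 2 * M ^+ 2 / mu & 0 <= gap k.+1].
Proof.
elim: k => [|k IH] badk.
  have [h1 h2 h3] := gap_step badk (t := 1) ltac:(lra).
  have := badk 0%N isT; rewrite /bad => b0.
  have e0 : G 0%N - gap 0%N = h (x 1%N) - h xs by rewrite /G /gap /=; ring.
  rewrite -e0 in b0; rewrite !expr1n !mul1r in h1 h2.
  move: h1 h2 h3 b0; move: (gap 1%N) (gap 0%N) (G 0%N) => a b c.
  move: (2 * M ^+ 2 / mu) => m *; have e0' := eps0.
  by split=> //; lra.
have [+ _ h3] := gap_step badk (t := 0) ltac:(lra).
rewrite expr0n/= !mul0r subr0 addr0 => h1.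
have [h4 h5 _] := IH (fun j jk => badk j (ltnW jk)).
by split=> //; exact: le_trans h1 _.
Qed.

Lemma gap_decrease k : (forall j, (j < k.+2)%N -> bad j) -> 0 < Q ->
  gap k.+2 <= gap k.+1 - G k.+1 ^+ 2 / (4 * Q).
Proof.
move=> badk Q0; have [h1 _ h3] := gap_step badk (t := 1) ltac:(lra).
have [g1 _ g2] := gap_later (fun j (jk : (j < k.+1)%N) => badk j (ltnW jk)).
have := badk k.+1 (ltnSn _); rewrite /bad => bk.
have e1 : G k.+1 - gap k.+1 = h (x k.+2) - h xs by rewrite /G /gap /=; ring.
rewrite -e1 in bk; rewrite expr1n !mul1r in h1.
(* The step t = 1 and a nonnegative next gap give G <= gap + Q <= 2 Q, so the optimal t = G / (2 Q)
   is admissible. *)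
have {h1 h3 bk} [G0 GQ] : 0 <= G k.+1 /\ G k.+1 <= 2 * Q.
  move: h1 h3 bk g1 g2; move: (gap k.+2) (gap k.+1) (G k.+1) => a b c *.
  have e0 := eps0.
  by split; lra.
pose t := G k.+1 / (2 * Q).
have t01 : 0 <= t <= 1.
  have Q2 : 0 < 2 * Q by rewrite mulr_gt0.
  by rewrite (divr_ge0 G0 (ltW Q2))/= ler_pdivrMr// mul1r.
have [h4 _ _] := gap_step badk t01.
apply: le_trans h4 _; rewrite /t le_eqVlt; apply/orP; left; apply/eqP.
by field; rewrite gt_eqF.
Qed.


Lemma bad_count N : (forall j, (j < N)%N -> bad j) ->
  N%:R <= Num.max 0
    (1 + Num.max 2 (D ^+ 2 / (mubar Db M mu L (norm2 xs) * mu * gam ^+ 2))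
           * ln (D ^+ 2 / (2 * eps * mu))).
Proof.
case: N => [|N] badN; first by rewrite le_max lexx.
have [gQ gM g0] := gap_later (fun j (jN : (j < 1)%N) => badN j (leq_trans jN (ltn0Sn N))).
(* One bad iterate already makes the logarithm nonnegative and forces two distinct cuts. *)
have Qeps : eps <= Q by lra.
have Q0 : 0 < Q := lt_le_trans eps0 Qeps.
have D0 : 0 < D.
  rewrite lt_neqAle diameter_ge0 andbT eq_sym; apply: contraTneq Q0 => D0.
  by rewrite /Q D0 expr0n/= mul0r ltxx.
have [a [b [aV bV ab]]] := diameter_conv_hull_gt0 D0.
have gam0 := PWidth_gt0 aV bV ab; have gamD := PWidth_le_diameter aV bV ab.
have muL := modulus_le_lipschitz g_cvx g_smooth n0.
have L0 : 0 < L := lt_le_trans mu0 muL.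
have M0 := lipschitz_const_ge0 V0.
have X0 : 0 <= X by rewrite addr_ge0 ?norm2_ge0// divr_ge0 ?(ltW mu0)// mulr_ge0.
have Db0 : 0 <= Db by exact: diameter_ge0.
pose B' := L / 2 + 5 / 12 * (2 * L * X ^+ 2 + 6 * M * X).
pose B := Db + 3 * (4 * M ^+ 2 / mu) + 6 * M * norm2 xs + 2 * L * (X ^+ 2 + 1).
have LX : 0 <= L * X ^+ 2 by rewrite mulr_ge0 ?sqr_ge0// ltW.
have MX : 0 <= M * X by rewrite mulr_ge0.
have B'0 : 0 < B' by rewrite /B'; lra.
(* Of the 2 L in [B], 6/5 L covers the L / 2 in [B']; the other 4/5 L pays for the additive 8/5 of
   [nat_le_log_rate], through gam <= D and mu <= L. *)
have BB' : 12 / 5 * B' + 4 / 5 * L <= B.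
  have -> : B = Db + 6 * (M * X) + 2 * L * (X ^+ 2 + 1) by rewrite /B; field; rewrite gt_eqF.
  by rewrite /B'; lra.
have B0 : 0 < B by lra.
(* The linear rate obtained from G^2 >= gam^2 gap / B' and the decrease G^2 / (4 Q). *)
pose r := gam ^+ 2 / (4 * Q * B').
have gam2 : 0 < gam ^+ 2 by rewrite exprn_gt0.
have r0 : 0 < r by apply: divr_gt0 => //; apply: mulr_gt0 => //; exact: mulr_gt0.
have -> : D ^+ 2 / (2 * eps * mu) = (eps / Q)^-1.
  by rewrite /Q; field; rewrite !gt_eqF.
have CE : D ^+ 2 / (mubar Db M mu L (norm2 xs) * mu * gam ^+ 2) = 4 * Q * B / gam ^+ 2.
  by rewrite /mubar -/B /Q; field; rewrite !gt_eqF.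
have C_ge : 12 / 5 / r + 8 / 5 <= D ^+ 2 / (mubar Db M mu L (norm2 xs) * mu * gam ^+ 2).
  rewrite CE; apply: (@le_trans _ _ (4 * Q * (12 / 5 * B' + 4 / 5 * L) / gam ^+ 2)); last first.
    by rewrite ler_pM2r ?invr_gt0// ler_pM2l// mulr_gt0.
  rewrite (_ : _ / gam ^+ 2 = 12 / 5 / r + 16 / 5 * Q * L / gam ^+ 2); last first.
    by rewrite /r; field; rewrite !gt_eqF.
  rewrite lerD2l ler_pdivlMr//.
  have -> : 16 / 5 * Q * L = 8 / 5 * (D ^+ 2 * (L / mu)) by rewrite /Q; field; rewrite gt_eqF.
  rewrite ler_pM2l; last lra.
  rewrite -[leLHS]mulr1; apply: ler_pM => //; first exact: sqr_ge0.
    by rewrite ler_sqr ?nnegrE ?diameter_ge0// ltW.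
  by rewrite ler_pdivlMr// mul1r.
(* The leading 1 of the bound pays for the first iteration, which only brings the gap below Q -
   eps. *)
rewrite le_max; apply/orP; right; rewrite -natr1 addrC lerD2l.
have ln0 : 0 <= ln (eps / Q)^-1.
  by apply: ln_ge0; rewrite invf_div ler_pdivlMr// mul1r.
apply: (@le_trans _ _ ((12 / 5 / r + 8 / 5) * ln (eps / Q)^-1)); last first.
  by apply: ler_wpM2r => //; rewrite le_max C_ge orbT.
have decr i : (i < N)%N -> gap i.+2 <= gap i.+1 - G i.+1 ^+ 2 / (4 * Q).
  by move=> iN; apply: gap_decrease => // j jN; apply: badN; exact: leq_trans jN _.
have later i : (i <= N)%N ->
    [/\ gap i.+1 <= Q - eps, gap i.+1 <= 2 * M ^+ 2 / mu & 0 <= gap i.+1].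
  by move=> iN; apply: gap_later => j jN; apply: badN; exact: leq_trans jN _.
have Q2 : 0 <= (Q ^+ 2)^-1 by rewrite invr_ge0 sqr_ge0.
have step i c : (i < N)%N -> c <= G i.+1 ^+ 2 -> gap i.+2 / Q <= gap i.+1 / Q - c / (4 * Q ^+ 2).
  move=> iN cG; have -> : gap i.+1 / Q - c / (4 * Q ^+ 2) = (gap i.+1 - c / (4 * Q)) / Q.
    by field; rewrite gt_eqF.
  rewrite ler_pM2r ?invr_gt0//; apply: le_trans (decr i iN) _.
  by rewrite lerD2l lerN2 ler_pM2r// invr_gt0 mulr_gt0.
apply: (nat_le_log_rate (d := fun i => gap i.+1 / Q)) => //.
- exact: divr_gt0.
- by rewrite ler_pdivrMr// mulrBl mul1r divfK ?gt_eqF.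
- by move=> i iN; have [_ _ gi] := later i iN; rewrite divr_ge0// ltW.
- move=> i iN; have [_ giM gi0] := later i (ltnW iN).
  have cont : forall j, (j < i.+1)%N -> continues V eps Vs x j.
    by apply: bad_continues => j jN; apply: badN; exact: leq_trans jN (ltnW _).
  have [Vi ViV] := run_models cont; have [xmin _ _ _] := run_iteration cont.
  have gMX : gap i.+1 <= M * X.
    apply: le_trans giM _; rewrite mulrDr; have := mulr_ge0 M0 (norm2_ge0 xs).
    by rewrite (_ : M * (2 * M / mu) = 2 * M ^+ 2 / mu); [lra|field; rewrite gt_eqF].
  have := model_gap_le n0 mu0 g_cvx g_smooth V0 xs_min Vi ViV xmin gMX.
  rewrite -/(gap i.+1) -/(G i.+1) -/B' => le_G.
  have /(step i _ iN) : gam ^+ 2 * gap i.+1 / B' <= G i.+1 ^+ 2 by rewrite ler_pdivrMr.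
  by rewrite (_ : _ / (4 * Q ^+ 2) = r * (gap i.+1 / Q))// /r; field; rewrite !gt_eqF.
- move=> i iN; have [_ _ gi0] := later i (ltnW iN).
  have /(step i _ iN) : (eps + gap i.+1) ^+ 2 <= G i.+1 ^+ 2.
    have := badN i.+1 iN; rewrite /bad => bi.
    have e1 : G i.+1 - gap i.+1 = h (x i.+2) - h xs by rewrite /G /gap /=; ring.
    rewrite -e1 ltrBrDr in bi.
    have e0 : 0 <= eps + gap i.+1 by rewrite addr_ge0// ltW.
    by rewrite ler_sqr ?nnegrE// ?(le_trans e0)// ltW.
  by rewrite (_ : _ / (4 * Q ^+ 2) = (eps / Q + gap i.+1 / Q) ^+ 2 / 4)//; field; rewrite gt_eqF.
Qed.

End KelleyRun.

Theorem theorem2p11 (R : realType) (n : nat) (g : 'rV[R]_n -> R) (mu L : R)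
    (V : {fset 'rV[R]_(n + 1)}) (xstar : 'rV[R]_n) (eps : R)
    (Vs : nat -> {fset 'rV[R]_(n + 1)}) (x : nat -> 'rV[R]_n)
    (p : nat -> 'rV[R]_(n + 1)) :
  0 < mu -> strongly_convex mu g -> smooth L g ->
  V != fset0%fset ->
  minimizer (fun y => g y + max_affine V y) xstar ->
  0 < eps ->
  kelley_run g V eps Vs x p ->
  let h := fun y => g y + max_affine V y in
  let D := diameter (conv_hull V) in
  let Db := diameter (rsubmx @` conv_hull V) in
  let Mf := lipschitz_const (max_affine V) in
  let gamma := PWidth V in
  let mubarpsi := mubar Db Mf mu L (norm2 xstar) in
  exists k : nat,
    [/\ k%:R <= Num.max 0
          (1 + Num.max 2 (D ^+ 2 / (mubarpsi * mu * gamma ^+ 2))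
               * ln (D ^+ 2 / (2 * eps * mu))),
        forall j, (j < k)%N -> continues V eps Vs x j
      & h (x k.+1) - h xstar <= eps].
Proof.
move=> mu0 g_cvx g_smooth V0 xs_min eps0 run.
(* In dimension 0 every iterate equals [xstar]; the count relies on mu <= L, hence on n > 0. *)
have [n0|n0] := posnP n; move=> h D Db Mf gamma mubarpsi.
  exists 0%N; split=> //; first by rewrite le_max lexx.
  suff -> : x 1%N = xstar by rewrite subrr ltW.
  apply/rowP => i; exfalso; suff : (0 < n)%N by rewrite n0.
  exact: leq_ltn_trans (leq0n i) (ltn_ord i).
set bound := Num.max 0 _.
have count N : (forall j, (j < N)%N -> eps < h (x j.+1) - h xstar) -> N%:R <= bound.
  exact: (bad_count n0 mu0 g_cvx g_smooth V0 xs_min eps0 run).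
(* If all iterates were bad, [count] would hold for every N, also beyond the bound. *)
have good : exists k, h (x k.+1) - h xstar <= eps.
  apply: contrapT => no_good; have := truncnS_gt bound; rewrite ltNge => /negP; apply.
  apply: count => j _; rewrite ltNge; apply/negP => le_eps.
  by apply: no_good; exists j.
(* All iterates before the first good one are bad, so the run does reach it. *)
exists (ex_minn good); case: ex_minnP => k le_eps kmin.
have bad j : (j < k)%N -> eps < h (x j.+1) - h xstar.
  by move=> jk; rewrite ltNge; apply/negP => /kmin; rewrite leqNgt jk.
split=> //; first exact: count.
exact: (bad_continues run bad).
Qed.
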